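(* Let $f(x;w)$ be a ResNet or a DenseNet (as defined in the context), with all weights i.i.d. standard normal, evaluated at a fixed input $x\in\mathbb{R}^{n_0}$ with $\|x\|_2=1$. Then for every non-negative even integer $m$ and every weight matrix $W^{\mathbf{k}}$ of the network, $$\mathbb{E}_w\big[(f_{(\mathbf{k})}(x;w))^{m}\big]=\mathbb{E}_w\big[(f_{\mathbf{k}}(x;w))^{m}\big].$$
   Context: $\phi(t)=\max(0,t)$ is the ReLU, applied coordinatewise. All weight entries are i.i.d. $\mathcal{N}(0,1)$. ResNet with residual branches of depth $m_b$: $f(x;w)=\frac{1}{\sqrt{n_L}}W^{L}y^L$ with final projection $W^{L}$ a row vector (distinct from the branch matrices $W^{L,h}$); $y^0=\frac{1}{\sqrt{n_0}}W^0x$; for $l\in[L]$, $y^l=y^{l-1}+\sqrt{\alpha_l}\,y^{l-1,m_b}$, where $y^{l-1,1}=\frac{1}{\sqrt{n_{l-1}}}W^{l,1}y^{l-1}$, $y^{l-1,h}=\frac{1}{\sqrt{n_{l-1,h-1}}}W^{l,h}q^{l-1,h-1}$ for $1<h\le m_b$, and $q^{l-1,h}=\sqrt2\,\phi(y^{l-1,h})$; $\alpha_l>0$ are scaling constants, $n_{l-1,h}$ is the dimension of $y^{l-1,h}$, $n_l$ that of $y^l$, and dimensions are compatible (so all $y^l$ have the same dimension). DenseNet: $f(x;w)=\frac{1}{\sqrt{n_L}}W^{L}y^L$ (final row-vector projection $W^L$); $y^0=\frac{1}{\sqrt{n_0}}W^0x$; for $l\in[L]$, $y^l=\sqrt{\frac{\alpha}{n_{l-1}\,l}}\sum_{h=0}^{l-1}W^{l,h}q^h$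 with $q^h=\sqrt2\,\phi(y^h)$, $\alpha>0$, and $W^{l,h}$ having $n_l$ rows and as many columns as the dimension of $q^h$. Path decomposition: for fixed $x,w$, $f(x;w)=\sum_{\gamma\in S}c_\gamma z_\gamma\prod_{l=1}^{|\gamma|}w_{\gamma,l}$, where $S$ is the set of input-to-output paths in the computation graph (through weight edges, identity skip connections and concatenations), $w_{\gamma,l}$ are the weights along $\gamma$, $c_\gamma$ collects the constant factors (scalings, $\sqrt2$'s, input coordinate), and $z_\gamma\in\{0,1\}$ indicates that all ReLUs along $\gamma$ are active. For a weight matrix $W^{\mathbf{k}}$, let $S_{\mathbf{k}}$ be the paths using a weight of $W^{\mathbf{k}}$, and $f_{\mathbf{k}}(x;w)=\sum_{\gamma\in S_{\mathbf{k}}}c_\gamma z_\gamma\prod_l w_{\gamma,l}$. Reduced network $f_{(\mathbf{k})}(x;w)$: the network obtained from $f$ by removing all connections bypassing $W^{\mathbf{k}}$ (same weights, recomputed activations). Concretely, for a ResNet and $\mathbf{k}=(l_k,h)$ a branch matrix, the recursion at layer $l_k$ becomes $y^{l_k}=\sqrt{\alpha_{l_k}}\,y^{l_k-1,m_b}$ (identity term dropped), all else unchanged; for a DenseNet and $\mathbf{k}=(l_k,h_k)$, $y^{l_k}=\sqrt{\frac{\alpha}{n_{l_k-1}l_k}}W^{l_k,h_k}q^{h_k}$ and for $l>l_k$, $y^l=\sqrt{\frac{\alpha}{n_{l-1}l}}\sum_{h=l_k}^{l-1}W^{l,h}q^h$; for the first and last projections $W^0,W^L$ nothing is removed. *)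

(* Defs.v *)
From HB Require Import structures.
From mathcomp Require Import all_boot all_order all_algebra.
From mathcomp Require Import all_classical all_reals all_analysis.
Set Implicit Arguments.
Unset Strict Implicit.
Unset Printing Implicit Defensive.
Import Order.TTheory GRing.Theory Num.Theory.
Local Open Scope ring_scope.

(* Identifier of a weight matrix:
   Win        = W^0       (first projection),
   Wmid l h   = W^{l,h}   (ResNet branch matrix / DenseNet matrix),
   Wout       = W^L       (final row-vector projection).               *)
Inductive wid := Win | Wmid of nat & nat | Wout.

Definition wid_code (a : wid) : nat * nat * nat :=
  match a with Win => (0, 0, 0) | Wmid l h => (1, l, h) | Wout => (2, 0, 0) end%N.
Definition wid_decode (c : nat * nat * nat) : wid :=
  match c with (0, _, _) => Win | (1, l, h) => Wmid l h | _ => Wout end%N.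
Lemma wid_codeK : cancel wid_code wid_decode. Proof. by case. Qed.
HB.instance Definition _ := Equality.copy wid (can_type wid_codeK).

(* A weight entry: (matrix, row, column). *)
Definition wkey := (wid * nat * nat)%type.
Definition weights (R : realType) := wkey -> R.
Definition W (R : realType) (w : weights R) (k : wid) (i j : nat) : R := w (k, i, j).

Definition mat_keys (k : wid) (r c : nat) : seq wkey :=
  [seq (k, i, j) | i <- iota 0 r, j <- iota 0 c].

Definition relu (R : realType) (t : R) : R := Num.max 0 t.
Definition gate (R : realType) (t : R) : R := if 0 < t then 1 else 0.
Definition sq2 (R : realType) : R := Num.sqrt 2.
Definition isq (R : realType) (n : nat) : R := (Num.sqrt (n%:R))^-1.

Definition upd (R : realType) (w : weights R) (k : wkey) (t : R) : weights R :=
  fun k' => if k' == k then t else w k'.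

(* gexp s G = E[G(w)] where the entries listed in s are i.i.d. N(0,1)
   (iterated integrals against the standard normal law); entries not in s
   are set to 0 (they are never read by the networks below). *)
Fixpoint gexp (R : realType) (s : seq wkey) (G : weights R -> \bar R) : \bar R :=
  match s with
  | [::] => G (fun _ => 0)
  | k :: s' => (\int[normal_prob (0:R) 1]_t gexp s' (fun w => G (upd w k t)))%E
  end.

(* m-th moment E_w[F(w)^m] (used for even m, where F^m >= 0). *)
Definition Emom (R : realType) (s : seq wkey) (F : weights R -> R) (m : nat) : \bar R :=
  gexp s (fun w => ((F w) ^+ m)%:E).

(* n0 = input dimension, n = dimension of every y^l, L = number of blocks,
   mb = depth of the residual branches,
   d l h = dimension n_{l-1,h} of y^{l-1,h} for 1 <= h < mb
   (y^{l-1,mb} has dimension n). *)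
Record resnet_arch := ResNetArch {
  rn_n0 : nat; rn_n : nat; rn_L : nat; rn_mb : nat; rn_d : nat -> nat -> nat }.

(* dimension of y^{l-1,h}; h = 0 stands for y^{l-1} itself *)
Definition rdim (A : resnet_arch) (l h : nat) : nat :=
  if h == 0%N then rn_n A else if h == rn_mb A then rn_n A else rn_d A l h.

(* y^{l-1,h} computed from yprev = y^{l-1}, (h = 0 gives y^{l-1}) *)
Fixpoint rn_branch (R : realType) (A : resnet_arch) (w : weights R) (l : nat)
    (yprev : nat -> R) (h : nat) : nat -> R :=
  match h with
  | 0 => yprev
  | h'.+1 => fun j => isq R (rdim A l h') *
      \sum_(i < rdim A l h') W w (Wmid l h'.+1) j i *
        (if h' == 0%N then rn_branch A w l yprev h' i
         else sq2 R * relu (rn_branch A w l yprev h' i))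
  end.

(* y^l; the identity skip connection of block `drop` is removed
   (drop = 0: nothing removed, blocks are numbered 1..L) *)
Fixpoint rn_y (R : realType) (A : resnet_arch) (alpha : nat -> R) (w : weights R)
    (x : nat -> R) (drop : nat) (l : nat) : nat -> R :=
  match l with
  | 0 => fun j => isq R (rn_n0 A) * \sum_(i < rn_n0 A) W w Win j i * x i
  | l'.+1 => fun j =>
      (if l'.+1 == drop then 0 else rn_y A alpha w x drop l' j)
      + Num.sqrt (alpha l'.+1) *
          rn_branch A w l'.+1 (rn_y A alpha w x drop l') (rn_mb A) j
  end.

Definition rn_out (R : realType) (A : resnet_arch) (alpha : nat -> R) (w : weights R)
    (x : nat -> R) (drop : nat) : R :=
  isq R (rn_n A) * \sum_(j < rn_n A) W w Wout 0 j * rn_y A alpha w x drop (rn_L A) j.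

Definition rn_f (R : realType) A alpha (w : weights R) x := rn_out A alpha w x 0.

Definition rn_reduced (R : realType) A alpha (w : weights R) x (k : wid) : R :=
  match k with Wmid l _ => rn_out A alpha w x l | _ => rn_out A alpha w x 0 end.

(* Path sums.  For every neuron, the pair (sum over all input->neuron
   paths gamma of c_gamma z_gamma prod w_gamma,
   same sum restricted to paths using an entry of W^k), computed by
   splitting each path at its last edge.  Gates z are those of f(x;w). *)
Fixpoint rn_psbranch (R : realType) (A : resnet_arch) (w : weights R) (l : nat)
    (yprev : nat -> R) (PA PB : nat -> R) (k : wid) (h : nat)
    : (nat -> R) * (nat -> R) :=
  match h with
  | 0 => (PA, PB)
  | h'.+1 =>
      let Q := rn_psbranch A w l yprev PA PB k h' in
      let g := fun i : nat => if h' == 0%N then 1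
                  else sq2 R * gate (rn_branch A w l yprev h' i) in
      (fun j => isq R (rdim A l h') *
          \sum_(i < rdim A l h') W w (Wmid l h'.+1) j i * g i * Q.1 i,
       fun j => isq R (rdim A l h') *
          \sum_(i < rdim A l h') W w (Wmid l h'.+1) j i * g i *
            (if k == Wmid l h'.+1 then Q.1 i else Q.2 i))
  end.

Fixpoint rn_ps (R : realType) (A : resnet_arch) (alpha : nat -> R) (w : weights R)
    (x : nat -> R) (k : wid) (l : nat) : (nat -> R) * (nat -> R) :=
  match l with
  | 0 =>
      let P := fun j => isq R (rn_n0 A) * \sum_(i < rn_n0 A) W w Win j i * x i in
      (P, fun j => if k == Win then P j else 0)
  | l'.+1 =>
      let P := rn_ps A alpha w x k l' in
      let V := rn_psbranch A w l'.+1 (rn_y A alpha w x 0 l') P.1 P.2 k (rn_mb A) in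
      (fun j => P.1 j + Num.sqrt (alpha l'.+1) * V.1 j,
       fun j => P.2 j + Num.sqrt (alpha l'.+1) * V.2 j)
  end.

(* f_k(x;w) = sum over paths using a weight of W^k *)
Definition rn_fk (R : realType) (A : resnet_arch) (alpha : nat -> R) (w : weights R)
    (x : nat -> R) (k : wid) : R :=
  let P := rn_ps A alpha w x k (rn_L A) in
  isq R (rn_n A) * \sum_(j < rn_n A) W w Wout 0 j *
     (if k == Wout then P.1 j else P.2 j).

Definition rn_keys (A : resnet_arch) : seq wkey :=
  mat_keys Win (rn_n A) (rn_n0 A)
  ++ flatten [seq flatten [seq mat_keys (Wmid l h) (rdim A l h) (rdim A l h.-1)
                          | h <- iota 1 (rn_mb A)] | l <- iota 1 (rn_L A)]
  ++ mat_keys Wout 1 (rn_n A).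

Definition rn_valid (A : resnet_arch) (k : wid) : bool :=
  match k with
  | Wmid l h => (1 <= l <= rn_L A)%N && (1 <= h <= rn_mb A)%N
  | _ => true
  end.

(* n0 = input dimension, L = depth, n l = dimension n_l of y^l (0 <= l <= L) *)
Record densenet_arch := DenseNetArch { dn_n0 : nat; dn_L : nat; dn_n : nat -> nat }.

(* which connections W^{l,h} are kept: drop = Some (lk,hk) is the reduced
   network for W^{lk,hk} *)
Definition dn_conn (drop : option (nat * nat)) (l h : nat) : bool :=
  match drop with
  | None => true
  | Some (lk, hk) => if l == lk then h == hk else if (lk < l)%N then (lk <= h)%N else true
  end.

Definition dn_y0 (R : realType) (D : densenet_arch) (w : weights R) (x : nat -> R)
    : nat -> R :=
  fun j => isq R (dn_n0 D) * \sum_(i < dn_n0 D) W w Win j i * x i.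

Definition dn_scale (R : realType) (D : densenet_arch) (alpha : R) (l : nat) : R :=
  Num.sqrt (alpha / ((dn_n D l.-1)%:R * l%:R)).

(* table h j |-> y^h_j for h <= l *)
Fixpoint dn_tab (R : realType) (D : densenet_arch) (alpha : R) (w : weights R)
    (x : nat -> R) (drop : option (nat * nat)) (l : nat) : nat -> nat -> R :=
  match l with
  | 0 => fun _ j => dn_y0 D w x j
  | l'.+1 =>
      let T := dn_tab D alpha w x drop l' in
      let new := fun j => dn_scale D alpha l'.+1 *
         \sum_(h < l'.+1 | dn_conn drop l'.+1 h)
            \sum_(i < dn_n D h) W w (Wmid l'.+1 h) j i * (sq2 R * relu (T h i)) in
      fun h j => if (h <= l')%N then T h j else new j
  end.

Definition dn_out (R : realType) (D : densenet_arch) (alpha : R) (w : weights R)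
    (x : nat -> R) (drop : option (nat * nat)) : R :=
  isq R (dn_n D (dn_L D)) *
  \sum_(j < dn_n D (dn_L D)) W w Wout 0 j * dn_tab D alpha w x drop (dn_L D) (dn_L D) j.

Definition dn_f (R : realType) D (alpha : R) w x := dn_out D alpha w x None.

Definition dn_reduced (R : realType) D (alpha : R) (w : weights R) x (k : wid) : R :=
  match k with
  | Wmid l h => dn_out D alpha w x (Some (l, h))
  | _ => dn_out D alpha w x None
  end.

(* path sums (all paths / paths through W^k) to the neurons y^h_j, h <= l,
   split at the last edge; gates are those of f(x;w) *)
Fixpoint dn_ps (R : realType) (D : densenet_arch) (alpha : R) (w : weights R)
    (x : nat -> R) (k : wid) (l : nat) : (nat -> nat -> R) * (nat -> nat -> R) :=
  match l with
  | 0 => (fun _ j => dn_y0 D w x j, fun _ j => if k == Win then dn_y0 D w x j else 0)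
  | l'.+1 =>
      let T := dn_ps D alpha w x k l' in
      let Y := dn_tab D alpha w x None l' in
      let newA := fun j => dn_scale D alpha l'.+1 *
         \sum_(h < l'.+1) \sum_(i < dn_n D h)
            W w (Wmid l'.+1 h) j i * (sq2 R * gate (Y h i)) * T.1 h i in
      let newB := fun j => dn_scale D alpha l'.+1 *
         \sum_(h < l'.+1) \sum_(i < dn_n D h)
            W w (Wmid l'.+1 h) j i * (sq2 R * gate (Y h i)) *
              (if k == Wmid l'.+1 h then T.1 h i else T.2 h i) in
      (fun h j => if (h <= l')%N then T.1 h j else newA j,
       fun h j => if (h <= l')%N then T.2 h j else newB j)
  end.

Definition dn_fk (R : realType) (D : densenet_arch) (alpha : R) (w : weights R)
    (x : nat -> R) (k : wid) : R :=
  let T := dn_ps D alpha w x k (dn_L D) in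
  isq R (dn_n D (dn_L D)) * \sum_(j < dn_n D (dn_L D)) W w Wout 0 j *
     (if k == Wout then T.1 (dn_L D) j else T.2 (dn_L D) j).

Definition dn_keys (D : densenet_arch) : seq wkey :=
  mat_keys Win (dn_n D 0) (dn_n0 D)
  ++ flatten [seq flatten [seq mat_keys (Wmid l h) (dn_n D l) (dn_n D h)
                          | h <- iota 0 l] | l <- iota 1 (dn_L D)]
  ++ mat_keys Wout 1 (dn_n D (dn_L D)).

Definition dn_valid (D : densenet_arch) (k : wid) : bool :=
  match k with
  | Wmid l h => (1 <= l <= dn_L D)%N && (h < l)%N
  | _ => true
  end.

(* Main.v *)
(* Multiply every weight by the signs of the hidden ReLU neurons at its two ends.
   This gauge transformation preserves the Gaussian law and all path products,
   and multiplies the preactivation of a neuron, for fixed gates, by its own sign.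
   For fixed weights the sign patterns therefore run through all gate patterns
   exactly once, so that summing over the signs makes the gates free.  With free
   gates the reduced network is by linearity the sum over the paths through W^k,
   hence both moments equal the same average over free gate patterns.  The
   exception is a neuron whose preactivation vanishes for every sign; almost surely
   no active path reaches it, so its gate is irrelevant. *)
Require Import Defs.
From HB Require Import structures.
From mathcomp Require Import all_boot all_order all_algebra.
From mathcomp Require Import all_classical all_reals all_analysis.
From mathcomp Require Import measurable_realfun zify ring.
Set Implicit Arguments.
Unset Strict Implicit.
Unset Printing Implicit Defensive.
Import Order.TTheory GRing.Theory Num.Theory.
Local Open Scope ring_scope.

(** * Gaussian integrals over the weights *)

Section normal_symmetry.
Context {R : realType}.
Local Notation mu := (@lebesgue_measure R).
Local Notation N01 := (normal_prob (0 : R) 1).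

(** Once gates are prescribed, the reduced network and [f_k] are the same polynomial in the weights.
    They differ only in the gates inserted: recomputed ones on one side, those of the full network
    on the other. For given weights the values need not agree, so the gates have to be averaged out
    before comparing.

    The gates are not independent: the sign of a preactivation depends on earlier gates, and in the
    full network also on paths avoiding $W^k$. What both networks share is a triangular structure,
    each preactivation reading only gates of lower rank, and this suffices to free the gates one
    after the other.

    The gates of the full network raise a further obstacle: a preactivation may vanish there while
    the gate still matters in the reduced network. Excluding this almost surely takes an argument
    specific to each architecture.

    Since [m] is even, all integrands are nonnegative; Tonelli applies without integrability, and
    the argument stays in [\bar R]. *)

Lemma normal_pdfN (x : R) : normal_pdf (0 : R) 1 (- x) = normal_pdf 0 1 x.
Proof. by rewrite !normal_pdfE ?oner_neq0// /normal_fun !subr0 sqrrN. Qed.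

Lemma normal_probN (A : set R) : measurable A ->
  pushforward N01 (-%R : _ -> measurableTypeR R) A = N01 A.
Proof.
move=> mA; rewrite /pushforward /normal_prob.
transitivity (\int[pushforward mu (-%R : _ -> measurableTypeR R)]_(x in A)
    (normal_pdf 0 1 x)%:E)%E.
  rewrite ge0_integral_pushforward//.
  - by apply: eq_integral => x _ /=; rewrite normal_pdfN.
  - by apply/measurable_EFinP; apply: measurable_funS (measurable_normal_pdf _ _).
  - by move=> y _; rewrite lee_fin normal_pdf_ge0.
by apply: eq_measure_integral => B mB _; exact: lebesgue_measureN.
Qed.

Lemma ge0_integral_normalN (g : R -> \bar R) :
  measurable_fun setT g -> (forall x, 0 <= g x)%E ->
  (\int[N01]_t g (- t)%R = \int[N01]_t g t)%E.
Proof.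
move=> mg g0.
rewrite [RHS](@eq_measure_integral _ _ R setT
  (pushforward N01 (-%R : _ -> measurableTypeR R))); last first.
  by move=> A mA _; exact/esym/normal_probN.
by rewrite ge0_integral_pushforward.
Qed.

Lemma normal_prob_set1 (a : R) : N01 [set a] = 0%E.
Proof.
have /null_content_dominatesP := @normal_prob_dominates R 0 1.
by apply => //; exact: lebesgue_measure_set1.
Qed.

End normal_symmetry.

(** * Measurability, Tonelli and null sets for iterated Gaussian integrals *)

Section weights_measurability.
Context {R : realType}.
Implicit Types (w : weights R) (s : seq wkey).
Local Notation N01 := (normal_prob (0 : R) 1).

(* Measurability of a function of the weights, tested along all families of
   weights with measurable entries: this needs no sigma-algebra on [weights R]. *)
Definition wmeasurable d (U : measurableType d) (G : weights R -> U) :=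
  forall d' (X : measurableType d') (phi : X -> weights R),
    (forall k, measurable_fun setT (phi ^~ k)) ->
    measurable_fun setT (fun x => G (phi x)).

(** Joint measurability in a parameter and the weights. The parameter space is arbitrary because
    induction over the integrated weights turns [X] into [X * R]. *)
Definition jmeasurable d (X : measurableType d) (G : X -> weights R -> \bar R) :=
  forall d' (Y : measurableType d') (psi : Y -> X) (phi : Y -> weights R),
    measurable_fun setT psi -> (forall k, measurable_fun setT (phi ^~ k)) ->
    measurable_fun setT (fun y => G (psi y) (phi y)).

Lemma measurable_upd d (Y : measurableType d) (phi : Y -> weights R) k
    (t : Y -> R) :
  measurable_fun setT t -> (forall k', measurable_fun setT (phi ^~ k')) ->
  forall k', measurable_fun setT (fun y => upd (phi y) k (t y) k').
Proof. by move=> mt mphi k'; rewrite /upd; case: (k' == k). Qed.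

Lemma jmeasurable_upd d (X : measurableType d) (G : X -> weights R -> \bar R) k :
  jmeasurable G ->
  jmeasurable (fun xt : X * R => fun w => G xt.1 (upd w k xt.2)).
Proof.
move=> mG d' Y psi phi mpsi mphi.
have [m1 m2] := (measurable_fun_pairP psi).1 mpsi.
by apply: (mG _ _ (fst \o psi) (fun y => upd (phi y) k (psi y).2)) => //;
  exact: measurable_upd.
Qed.

Lemma wmeasurable_upd (G : weights R -> \bar R) k :
  wmeasurable G -> jmeasurable (fun t w => G (upd w k t)).
Proof.
move=> mG d' Y psi phi mpsi mphi.
by apply: (mG _ _ (fun y => upd (phi y) k (psi y))); exact: measurable_upd.
Qed.

Lemma wmeasurable_updr d (U : measurableType d) (G : weights R -> U) k t :
  wmeasurable G -> wmeasurable (fun w => G (upd w k t)).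
Proof.
move=> mG d' Y phi mphi.
by apply: (mG _ _ (fun y => upd (phi y) k t)); apply: measurable_upd.
Qed.

Lemma gexp_ge0 s (G : weights R -> \bar R) :
  (forall w, 0 <= G w)%E -> (0 <= gexp s G)%E.
Proof. by elim: s G => //= k s IH G G0; apply: integral_ge0 => t _; exact: IH. Qed.

Lemma measurable_gexp s d (X : measurableType d) (G : X -> weights R -> \bar R) :
  jmeasurable G -> (forall x w, 0 <= G x w)%E ->
  measurable_fun setT (fun x => gexp s (G x)).
Proof.
elim: s d X G => [|k s IH] d X G mG G0 /=.
  by apply: (mG _ _ id (fun _ _ => 0)).
apply: (@measurable_fun_fubini_tonelli_F _ _ _ _ _ N01
  (fun xt => gexp s (fun w => G xt.1 (upd w k xt.2)))) => /=.
  exact: (IH _ (X * R)%type (fun xt w => G xt.1 (upd w k xt.2))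
    (jmeasurable_upd k mG)).
by move=> xt; exact: gexp_ge0.
Qed.

Lemma measurable_gexp_upd s k (G : weights R -> \bar R) :
  wmeasurable G -> (forall w, 0 <= G w)%E ->
  measurable_fun setT (fun t => gexp s (fun w => G (upd w k t))).
Proof.
move=> mG G0.
exact: (@measurable_gexp s _ _ (fun t w => G (upd w k t)) (wmeasurable_upd k mG)).
Qed.

Lemma gexpD s (G H : weights R -> \bar R) :
  wmeasurable G -> (forall w, 0 <= G w)%E ->
  wmeasurable H -> (forall w, 0 <= H w)%E ->
  (gexp s (fun w => G w + H w) = gexp s G + gexp s H)%E.
Proof.
elim: s G H => //= k s IH G H mG G0 mH H0.
rewrite -ge0_integralD//.
- by apply: eq_integral => t _; rewrite IH//; exact: wmeasurable_updr.
- by move=> t _; exact: gexp_ge0.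
- exact: measurable_gexp_upd.
- by move=> t _; exact: gexp_ge0.
- exact: measurable_gexp_upd.
Qed.

Lemma gexp_integral s (H : R -> weights R -> \bar R) :
  jmeasurable H -> (forall x w, 0 <= H x w)%E ->
  (\int[N01]_x gexp s (H x) = gexp s (fun w => \int[N01]_x H x w))%E.
Proof.
elim: s H => //= k s IH H mH H0.
rewrite (@fubini_tonelli _ _ _ _ _ N01 N01
  (fun xt => gexp s (fun w => H xt.1 (upd w k xt.2))))//=; last 2 first.
- exact: (@measurable_gexp s _ _ (fun xt w => H xt.1 (upd w k xt.2))
    (jmeasurable_upd k mH)).
- by move=> xt; exact: gexp_ge0.
apply: eq_integral => t _.
rewrite (IH (fun x w => H x (upd w k t)))// => d Y psi phi mpsi mphi.
by apply: (mH _ _ psi (fun y => upd (phi y) k t)) => //; apply: measurable_upd.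
Qed.

Lemma eq_gexp s (G H : weights R -> \bar R) : G =1 H -> gexp s G = gexp s H.
Proof. by move=> /funext ->. Qed.

Lemma gexp0 s : gexp s (fun _ : weights R => 0%E) = 0%E.
Proof. by elim: s => //= k s ->; rewrite integral0. Qed.

Lemma upd_comm w k k' t t' : k != k' ->
  upd (upd w k t) k' t' = upd (upd w k' t') k t.
Proof.
move=> kk'; apply/funext => x; rewrite /upd.
by have [->|//] := eqVneq x k'; rewrite eq_sym (negbTE kk').
Qed.

(** By Tonelli the integral over the weight [k] can be carried out before the others, wherever [k]
    stands in [s]. *)
Lemma gexp_null_coord s k (H : weights R -> \bar R) :
  k \in s -> wmeasurable H -> (forall w, 0 <= H w)%E ->
  (forall w, \int[N01]_t H (upd w k t) = 0)%E -> gexp s H = 0%E.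
Proof.
elim: s H => //= k1 s IH H; rewrite inE; have [<- _|nk /= ks] := eqVneq k k1.
  move=> mH H0 Hk; rewrite (@gexp_integral s (fun t w => H (upd w k t)))//.
    by rewrite -[RHS](gexp0 s); apply: eq_gexp => w.
  exact: wmeasurable_upd.
move=> mH H0 Hk; apply: integral0_eq => t1 _; apply: IH => //.
  exact: wmeasurable_updr.
by move=> w; under eq_integral do rewrite upd_comm//.
Qed.

(** Almost sure validity of [Q]: the exceptional weights lie where a nonnegative measurable [H] of
    zero expectation is nonzero. The encoding avoids a product measure on [weights R] and covers
    non-measurable [Q]. *)
Definition gae s (Q : weights R -> Prop) := exists H : weights R -> \bar R,
  [/\ wmeasurable H, (forall w, 0 <= H w)%E, gexp s H = 0%E &
      forall w, H w = 0%E -> Q w].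

Lemma gaeT s (Q : weights R -> Prop) : (forall w, Q w) -> gae s Q.
Proof.
move=> HQ; exists (fun _ => 0%E); split=> //; exact: gexp0.
Qed.

Lemma gae_impl s (Q Q' : weights R -> Prop) :
  (forall w, Q w -> Q' w) -> gae s Q -> gae s Q'.
Proof. by move=> QQ' [H [? ? ? HQ]]; exists H; split=> // w /HQ/QQ'. Qed.

Lemma gae_and s (Q Q' : weights R -> Prop) :
  gae s Q -> gae s Q' -> gae s (fun w => Q w /\ Q' w).
Proof.
move=> [H [mH H0 HE HQ]] [H' [mH' H0' HE' HQ']].
exists (fun w => H w + H' w)%E; split.
- by move=> d X phi mphi; apply: emeasurable_funD; [exact: mH|exact: mH'].
- by move=> w; rewrite adde_ge0.
- by rewrite gexpD// HE HE' adde0.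
- move=> w /eqP; rewrite padde_eq0// => /andP[/eqP/HQ ? /eqP/HQ' ?]; split=> //.
Qed.

Lemma gae_all s (T : eqType) (r : seq T) (Q : T -> weights R -> Prop) :
  (forall i, i \in r -> gae s (Q i)) ->
  gae s (fun w => forall i, i \in r -> Q i w).
Proof.
elim: r => [|a r IH] H; first exact: gaeT.
have Ha := H a (mem_head _ _).
have /(gae_and Ha) : gae s (fun w => forall i, i \in r -> Q i w).
  by apply: IH => i ir; apply: H; rewrite inE ir orbT.
by apply: gae_impl => w [Qa Qr] i; rewrite inE => /predU1P[->//|/Qr].
Qed.

Lemma gae_ord s n (Q : nat -> weights R -> Prop) :
  (forall i, (i < n)%N -> gae s (Q i)) ->
  gae s (fun w => forall i, (i < n)%N -> Q i w).
Proof.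
move=> H; have := @gae_all s _ (iota 0 n) Q.
by case=> [i|h [? ? ? hQ]]; [rewrite mem_iota => /H|exists h; split=> // w /hQ Hw i;
  move: (Hw i); rewrite mem_iota].
Qed.

(** For almost every value of the first weight, the remaining expectation of the witness [K]
    vanishes too, so [K] with that weight fixed is a witness for the remaining weights. *)
Lemma gae_eq s (G H : weights R -> \bar R) :
  wmeasurable G -> (forall w, 0 <= G w)%E ->
  wmeasurable H -> (forall w, 0 <= H w)%E ->
  gae s (fun w => G w = H w) -> gexp s G = gexp s H.
Proof.
move=> mG G0 mH H0 [K [mK K0 KE KQ]].
elim: s G H K mG G0 mH H0 mK K0 KE KQ => /= [|k s IH] G H K mG G0 mH H0 mK K0 KE KQ.
  exact: KQ.
have mK' := measurable_gexp_upd s k mK K0.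
apply: ge0_ae_eq_integral => //.
- exact: measurable_gexp_upd.
- exact: measurable_gexp_upd.
- by move=> t _; exact: gexp_ge0.
- by move=> t _; exact: gexp_ge0.
have : ae_eq N01 setT (fun t => gexp s (fun w => K (upd w k t))) (cst 0%E).
  apply/ae_eq_integral_abs => //; rewrite -[RHS]KE; apply: eq_integral => t _.
  by rewrite gee0_abs// gexp_ge0.
apply: filterS => t /= /(_ I) Kt _.
apply: (IH _ _ (fun w => K (upd w k t))) => //; try exact: wmeasurable_updr.
by move=> w /KQ.
Qed.

(** Where the slope [b] is nonzero, [a] has a single root as a function of the weight [k], and a
    point is null for the normal law. *)
Lemma gae_affine s k (a b : weights R -> R) :
  k \in s -> wmeasurable a -> wmeasurable b ->
  (forall w t, a (upd w k t) = a w + (t - w k) * b w) ->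
  (forall w t, b (upd w k t) = b w) ->
  gae s (fun w => a w = 0 -> b w = 0).
Proof.
move=> ks ma mb aE bE.
(* Indicator of the event to exclude: [a w = 0] with [b w] nonzero. *)
pose H w : \bar R := if a w == 0 then (if b w == 0 then 0%E else 1%E) else 0%E.
have mH : wmeasurable H.
  move=> d X phi mphi; apply: measurable_fun_ifT => //.
    by apply: measurable_fun_eqr => //; exact: ma.
  by apply: measurable_fun_ifT => //; apply: measurable_fun_eqr => //; exact: mb.
have H0 w : (0 <= H w)%E by rewrite /H; case: ifP => // _; case: ifP.
exists H; split => //.
- apply: (gexp_null_coord ks) => //.
  move=> w; have [b0|b0] := eqVneq (b w) 0.
      by apply: integral0_eq => t _; rewrite /H bE b0 eqxx if_same.
    pose t0 := w k - a w / b w.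
    transitivity (\int[N01]_t (\1_[set t0] t)%:E)%E; last first.
      by rewrite integral_indic// setIT; exact: normal_prob_set1.
    apply: eq_integral => t _; rewrite /H aE bE (negbTE b0) indicE.
    have -> : (t \in [set t0]%classic) = (t == t0 :> R).
      by apply/idP/eqP; rewrite inE.
    have -> : (a w + (t - w k) * b w == 0) = (t == t0 :> R); last by case: eqP.
    rewrite -(inj_eq (mulIf (invr_neq0 b0))) mul0r mulrDl mulfK//.
    by rewrite /t0 -[RHS]subr_eq0 opprB addrCA.
- by move=> w; rewrite /H; case: ifP => [_|/eqP//]; case: ifP => [/eqP//|_ /eqP];
    rewrite onee_eq0.
Qed.

Definition wflip (sg : wkey -> bool) w : weights R := fun k => (-1) ^+ sg k * w k.

Lemma wmeasurable_wflip d (U : measurableType d) (G : weights R -> U) sg :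
  wmeasurable G -> wmeasurable (fun w => G (wflip sg w)).
Proof.
move=> mG d' X phi mphi; apply: (mG _ _ (fun x => wflip sg (phi x))) => k.
by apply: measurable_funM.
Qed.

(** Symmetry of the normal law, one weight at a time. Weights outside [s] are 0, hence fixed by the
    flip. *)
Lemma gexp_wflip s sg (G : weights R -> \bar R) :
  wmeasurable G -> (forall w, 0 <= G w)%E ->
  gexp s (fun w => G (wflip sg w)) = gexp s G.
Proof.
elim: s G => /= [|k s IH] G mG G0.
  by congr G; apply/funext => k; rewrite /wflip mulr0.
have E t : gexp s (fun w => G (wflip sg (upd w k t))) =
           gexp s (fun w => G (upd w k ((-1) ^+ sg k * t))).
  rewrite -[RHS]IH//; last exact: wmeasurable_updr.
  apply: eq_gexp => w; congr G; apply/funext => k'; rewrite /wflip /upd.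
  by case: eqP => // ->.
under eq_integral do rewrite E.
case: (sg k); last by apply: eq_integral => t _; rewrite expr0 mul1r.
under eq_integral do rewrite expr1 mulN1r.
apply: (@ge0_integral_normalN R (fun t => gexp s (fun w => G (upd w k t)))).
  exact: measurable_gexp_upd.
by move=> t; exact: gexp_ge0.
Qed.

(** * Measurability of the operations that build the networks *)

Lemma eq_wmeasurable (f g : weights R -> R) :
  f =1 g -> wmeasurable g -> wmeasurable f.
Proof. by move=> /funext ->. Qed.

Lemma wmeasurable_cst (c : R) : wmeasurable (fun _ => c).
Proof. by move=> ? ? ? ?; exact: measurable_cst. Qed.

Lemma wmeasurable_W k i j : wmeasurable (fun w => W w k i j).
Proof. by move=> d X phi mphi; exact: mphi. Qed.

Lemma wmeasurableD (f g : weights R -> R) :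
  wmeasurable f -> wmeasurable g -> wmeasurable (fun w => f w + g w).
Proof. by move=> mf mg d X phi mphi; apply: measurable_funD; [exact: mf|exact: mg]. Qed.

Lemma wmeasurableM (f g : weights R -> R) :
  wmeasurable f -> wmeasurable g -> wmeasurable (fun w => f w * g w).
Proof. by move=> mf mg d X phi mphi; apply: measurable_funM; [exact: mf|exact: mg]. Qed.

Lemma wmeasurable_sum (I : Type) (r : seq I) (P : pred I) (f : I -> weights R -> R) :
  (forall i, wmeasurable (f i)) -> wmeasurable (fun w => \sum_(i <- r | P i) f i w).
Proof.
move=> mf d X phi mphi; under eq_fun do rewrite -big_filter.
by apply: measurable_sum => i; exact: mf.
Qed.

Lemma wmeasurable_relu (f : weights R -> R) :
  wmeasurable f -> wmeasurable (fun w => relu (f w)).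
Proof. by move=> mf d X phi mphi; apply: measurable_maxr => //; exact: mf. Qed.

Lemma wmeasurable_gate (f : weights R -> R) :
  wmeasurable f -> wmeasurable (fun w => gate (f w)).
Proof.
move=> mf d X phi mphi; apply: measurable_fun_ifT => //.
by apply: measurable_fun_ltr => //; exact: mf.
Qed.

Lemma wmeasurable_moment (f : weights R -> R) m :
  wmeasurable f -> wmeasurable (fun w => ((f w) ^+ m)%:E).
Proof.
move=> mf d X phi mphi; apply/measurable_EFinP.
by apply: measurable_funX; exact: mf.
Qed.

End weights_measurability.

(** * Averaging over gauge signs *)

Section assignment_sums.
Context {R : realType} {I : eqType}.
Implicit Types (s : seq I) (z : I -> bool) (F : (I -> bool) -> \bar R).

Definition setg z v b : I -> bool := fun u => if u == v then b else z u.

(** Sum over all assignments of [s], with values off [s] taken from [z]. Since the head is set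
    first, a chosen prefix leaves a sum of the same kind over the suffix. *)
Fixpoint asum s z F : \bar R :=
  if s is v :: s' then (asum s' (setg z v true) F + asum s' (setg z v false) F)%E
  else F z.

Lemma setg_comm z u v b c : u != v ->
  setg (setg z v b) u c = setg (setg z u c) v b.
Proof.
move=> uv; apply/funext => x; rewrite /setg.
by have [->|//] := eqVneq x u; rewrite (negbTE uv).
Qed.

Lemma eq_asum s z z' F : (forall u, u \notin s -> z u = z' u) ->
  asum s z F = asum s z' F.
Proof.
elim: s z z' => [|v s IH] z z' zz' /=; first by congr F; apply/funext => u; exact: zz'.
by congr (_ + _)%E; apply: IH => u us; rewrite /setg; case: eqVneq => // uv;
  apply: zz'; rewrite inE (negbTE uv).
Qed.

Lemma asum_ge0 s z F : (forall z, 0 <= F z)%E -> (0 <= asum s z F)%E.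
Proof. by move=> F0; elim: s z => //= v s IH z; rewrite adde_ge0. Qed.

Lemma asum_cst s z z' (c : \bar R) : asum s z (fun _ => c) = asum s z' (fun _ => c).
Proof. by elim: s z z' => //= v s IH z z'; congr (_ + _)%E; exact: IH. Qed.

(** Cancels the number of assignments. The moments may a priori be infinite, but doubling is
    injective on [\bar R] as well. *)
Lemma asum_cst_inj s z (c c' : \bar R) :
  asum s z (fun _ => c) = asum s z (fun _ => c') -> c = c'.
Proof.
elim: s z => //= v s IH z.
rewrite (asum_cst s (setg z v true) (setg z v false)).
rewrite (asum_cst s (setg z v true) (setg z v false) c') => H.
apply: (IH (setg z v false)); move: H.
move: (asum s _ _) (asum s _ _) => [x| |] [y| |] //=; rewrite -!EFinD => -[].
by rewrite -!mulr2n => /eqP; rewrite eqr_pMn2r// => /eqP ->.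
Qed.

(** * From gates driven by signs to free gates *)

Section resample.
Variables (vs : seq I) (rk : I -> nat) (A : (I -> bool) -> I -> R).
Variables (zf : (I -> bool) -> I -> bool) (F : (I -> bool) -> \bar R).
Hypothesis vs_uniq : uniq vs.
Hypothesis vs_sorted : sorted (relpre rk leq) vs.
Hypothesis zfE : forall e v, zf e v = (v \in vs) && (0 < (-1) ^+ e v * A (zf e) v).
Hypothesis A_local : forall z z' v,
  (forall u, (rk u < rk v)%N -> z u = z' u) -> A z v = A z' v.
Hypothesis F_deg : forall z v b, (forall u, u \notin vs -> z u = false) ->
  v \in vs -> A z v = 0 -> F (setg z v b) = F z.

Let zf_out e u : u \notin vs -> zf e u = false.
Proof. by rewrite zfE => /negbTE ->. Qed.

(** The preactivation of [u] reads only gates of rank below that of [u], hence below that of [v]; so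
    the sign at [v] can affect only [v] and neurons of higher rank. *)
Let zf_local e e' v : (forall u, u != v -> e u = e' u) ->
  forall u, u != v -> (rk u <= rk v)%N -> zf e u = zf e' u.
Proof.
move=> ee' u; have [n] := ubnP (rk u); elim: n u => // n IH u un uv ruv.
rewrite !zfE ee'//; congr (_ && (_ < _ * _)); apply: A_local => x xu.
apply: IH; first by rewrite (leq_trans xu).
  by apply: contraTneq xu => ->; rewrite -leqNgt.
by rewrite (leq_trans (ltnW xu)).
Qed.

(** The neurons of [s] have rank at least that of [v], so assigning them keeps [A z v = 0], and
    [F_deg] applies to every term of the sum. *)
Let asum_deg s z v b : (forall u, u \notin vs -> z u = false) ->
  {subset s <= vs} -> v \in vs -> v \notin s -> (forall u, u \in s -> (rk v <= rk u)%N) ->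
  A z v = 0 -> asum s (setg z v b) F = asum s z F.
Proof.
elim: s z => [|u s IH] z zout svs vvs vs' rv Az; first exact: F_deg.
move: vs'; rewrite inE negb_or => /andP[vu vs'] /=.
have H c : asum s (setg (setg z v b) u c) F = asum s (setg z u c) F.
  rewrite setg_comm 1?eq_sym//; apply: IH => //.
  - move=> x xvs; rewrite /setg; case: eqVneq => [xu|_]; last exact: zout.
    by move: xvs; rewrite xu svs// mem_head.
  - by move=> x xs; apply: svs; rewrite inE xs orbT.
  - by move=> x xs; apply: rv; rewrite inE xs orbT.
  - rewrite -Az; apply: A_local => x xv; rewrite /setg; case: eqVneq => // xu.
    by move: xv; rewrite xu ltnNge rv// mem_head.
by rewrite !H.
Qed.

(** Form suited to induction: the signs on the prefix [p] are chosen and determine its gates, and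
    only the gates of the suffix become free. *)
Let resample_suffix s p e : vs = p ++ s ->
  asum s e (fun e => F (zf e)) = asum s (zf e) F.
Proof.
elim: s p e => [//|v s IH] p e vsE /=.
have IHv b : asum s (setg e v b) (fun e => F (zf e)) = asum s (zf (setg e v b)) F.
  by apply: (IH (rcons p v)); rewrite cat_rcons.
have : uniq (p ++ v :: s) by rewrite -vsE.
rewrite cat_uniq /= => /and3P[_ _ /andP[vs' _]].
have leT : transitive (relpre rk leq) by move=> x y t; exact: leq_trans.
have : pairwise (relpre rk leq) (p ++ v :: s).
  by rewrite -sorted_pairwise// -vsE.
rewrite pairwise_cat /= => /and3P[/allrelP rp _ /andP[/allP rs _]].
have vvs : v \in vs by rewrite vsE mem_cat mem_head orbT.
have agree b u : u != v -> setg e v b u = e u by rewrite /setg => /negbTE ->.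
(* The value [A (zf e) v] does not involve the sign of [v], so that sign alone decides the gate of
   [v]. The gates of [p] stay as they were, and those of [s] are summed over. *)
have step b : asum s (zf (setg e v b)) F =
    asum s (setg (zf e) v (0 < (-1) ^+ b * A (zf e) v)) F.
  apply: eq_asum => u us; rewrite [RHS]/setg; case: eqVneq => [->|uv].
    rewrite zfE vvs /= /setg eqxx; congr (_ < _ * _); apply: A_local => x xv.
    apply: (zf_local (agree b)) (ltnW xv).
    by apply: contraTneq xv => ->; rewrite ltnn.
  have [uvs|uvs] := boolP (u \in vs); last by rewrite !zf_out.
  apply: (zf_local (agree b)) => //; apply: rp; rewrite ?mem_head//.
  by move: uvs; rewrite vsE mem_cat inE (negbTE uv) (negbTE us) !orbF.
rewrite !IHv !step expr1 expr0 mulN1r mul1r oppr_gt0.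
(* A nonzero preactivation realises each gate value once, in an order given by its sign. If it is
   zero, both signs close the gate, and all four terms are equal by [asum_deg]. *)
case: ltgtP => // A0.
  by rewrite addeC.
have deg b : asum s (setg (zf e) v b) F = asum s (zf e) F.
  apply: asum_deg => //; first by move=> u; exact: zf_out.
  by move=> u us; rewrite vsE mem_cat inE us !orbT.
by rewrite !deg.
Qed.

Lemma asum_resample :
  asum vs (fun _ => false) (fun e => F (zf e)) = asum vs (fun _ => false) F.
Proof.
rewrite (@resample_suffix vs [::])//; apply: eq_asum => u; exact: zf_out.
Qed.

End resample.

Lemma wmeasurable_asum s z (G : weights R -> (I -> bool) -> \bar R) :
  (forall z, wmeasurable (G ^~ z)) -> wmeasurable (fun w => asum s z (G w)).
Proof.
move=> mG; elim: s z => [|v s IH] z /=; first exact: mG.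
by move=> d X phi mphi; apply: emeasurable_funD; apply: IH.
Qed.

Lemma gexp_asum keys s z (G : weights R -> (I -> bool) -> \bar R) :
  (forall z, wmeasurable (G ^~ z)) -> (forall w z, 0 <= G w z)%E ->
  gexp keys (fun w => asum s z (G w)) = asum s z (fun z => gexp keys (G ^~ z)).
Proof.
move=> mG G0; elim: s z => //= v s IH z; rewrite gexpD ?IH//;
  by [exact: wmeasurable_asum|move=> w; exact: asum_ge0].
Qed.

Lemma gae_assignments keys (vs : seq I) (Q : (I -> bool) -> weights R -> Prop) :
  (forall z, gae keys (Q z)) ->
  gae keys (fun w => forall z, (forall u, u \notin vs -> z u = false) -> Q z w).
Proof.
move=> HQ.
(* An assignment supported on [vs] is encoded by its tuple of values, so that only finitely many
   null sets are united. *)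
have : gae keys (fun w => forall m : (size vs).-tuple bool,
    m \in enum {: (size vs).-tuple bool} -> Q (fun v => v \in mask m vs) w).
  by apply: gae_all => m _; exact: HQ.
apply: gae_impl => w Qw z zout.
have := Qw (map_tuple z (in_tuple vs)) (mem_enum _ _); congr (Q _ w).
apply/funext => v; rewrite /= -filter_mask mem_filter.
by have [|/zout ->] := boolP (v \in vs); rewrite ?andbT ?andbF.
Qed.

End assignment_sums.

Section gauge_average.
Context {R : realType} {I : eqType}.
Variables (keys : seq wkey) (vs : seq I) (rk : I -> nat).
Variables (sigma : (I -> bool) -> wkey -> bool).
Variables (Y : weights R -> I -> R) (A : weights R -> (I -> bool) -> I -> R).
Variables (F : weights R -> (I -> bool) -> R) (f : weights R -> R).
Let gates w v := (v \in vs) && (0 < Y w v).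
Hypothesis vs_uniq : uniq vs.
Hypothesis vs_sorted : sorted (relpre rk leq) vs.
Hypothesis fE : forall w, f w = F w (gates w).
Hypothesis YE : forall w v, v \in vs -> A w (gates w) v = Y w v.
Hypothesis A_gauge : forall e w z v, v \in vs ->
  A (wflip (sigma e) w) z v = (-1) ^+ e v * A w z v.
Hypothesis F_gauge : forall e w z, F (wflip (sigma e) w) z = F w z.
Hypothesis A_local : forall w z z' v,
  (forall u, (rk u < rk v)%N -> z u = z' u) -> A w z v = A w z' v.
Hypothesis F_deg : forall z, gae keys (fun w => forall v, v \in vs ->
  A w z v = 0 -> forall b, F w (setg z v b) = F w z).
Hypothesis f_meas : wmeasurable f.
Hypothesis F_meas : forall z, wmeasurable (F ^~ z).

(* Averaging over the gauge signs turns the actual gates into free ones: for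
   fixed weights, every gate pattern is realised by exactly one sign pattern,
   up to gates on which [F] does not depend. *)
Lemma gauge_average m : ~~ odd m ->
  asum vs (fun _ => false) (fun _ => Emom keys f m) =
  gexp keys (fun w => asum vs (fun _ => false) (fun z => (F w z ^+ m)%:E)).
Proof.
move=> em.
have pow0 (x : R) : (0 <= (x ^+ m)%:E)%E by rewrite lee_fin exprn_even_ge0.
have mfm := wmeasurable_moment m f_meas.
(* Each flip preserves the law, so every summand may be evaluated at its own flipped weights. *)
transitivity (asum vs (fun _ => false)
    (fun e => gexp keys (fun w => (f (wflip (sigma e) w) ^+ m)%:E))).
  by congr asum; apply/funext => e; 
    rewrite (@gexp_wflip _ _ _ (fun w => (f w ^+ m)%:E)).
rewrite -(@gexp_asum R I keys vs _ (fun w e => (f (wflip (sigma e) w) ^+ m)%:E));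
  [|by move=> z; exact: (wmeasurable_wflip _ mfm)|by []].
apply: gae_eq.
- by apply: wmeasurable_asum => z; exact: (wmeasurable_wflip _ mfm).
- by move=> w; exact: asum_ge0.
- by apply: wmeasurable_asum => z; exact: wmeasurable_moment.
- by move=> w; exact: asum_ge0.
have := gae_assignments vs F_deg; apply: gae_impl => w deg.
(* The gates realised after the flip; covariance of [A] gives them the recursive form that
   resampling requires. *)
pose zf e := gates (wflip (sigma e) w).
rewrite -(@asum_resample R I vs rk (A w) zf (fun z => (F w z ^+ m)%:E)).
- by congr asum; apply/funext => e; rewrite fE F_gauge.
- by [].
- by [].
- move=> e v; rewrite {1}/zf /gates; have [vvs|//] := boolP (v \in vs).
  by rewrite -YE// A_gauge.
- by move=> z z' v; exact: A_local.
- by move=> z v b zout vvs Az; rewrite (deg z zout v vvs Az).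
Qed.

End gauge_average.

(** * Vanishing of Gaussian rows *)

Section networks_common.
Context {R : realType}.
Implicit Types (w : weights R) (s : seq wkey).

Lemma reluE (t : R) : relu t = if 0 < t then t else 0.
Proof. by rewrite /relu maxEle; case: ltgtP => // ->. Qed.

Lemma isq_neq0 n : (0 < n)%N -> isq R n != 0.
Proof. by move=> n0; rewrite invr_neq0// gt_eqF// sqrtr_gt0 ltr0n. Qed.

Lemma sq2_neq0 : sq2 R != 0.
Proof. by rewrite gt_eqF// sqrtr_gt0. Qed.

Lemma W_upd w k j i t k' j' i' :
  W (upd w (k, j, i) t) k' j' i' =
  if (k', j', i') == (k, j, i) then t else W w k' j' i'.
Proof. by []. Qed.

Lemma W_upd_neq w k j i t k' j' i' : k' != k ->
  W (upd w (k, j, i) t) k' j' i' = W w k' j' i'.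
Proof. by move=> kk'; rewrite W_upd !xpair_eqE (negbTE kk'). Qed.

Lemma Wmid_eq l h l' h' : (Wmid l h == Wmid l' h') = (l == l') && (h == h').
Proof. by apply/eqP/andP => [[-> ->]//|[/eqP -> /eqP ->]]. Qed.

Lemma mem_mat_keys k r c j i : (j < r)%N -> (i < c)%N -> (k, j, i) \in mat_keys k r c.
Proof.
move=> jr ic; apply/allpairsP; exists (j, i); rewrite /= !mem_iota /=.
by rewrite !add0n jr ic.
Qed.

(** Neither [c] nor the inputs [u] read row [j], so the expression is affine in each weight of that
    row, with slope [kap * u i]. *)
Lemma gae_row s k j n (kap : R) (c : weights R -> R) (u : nat -> weights R -> R) :
  (forall i, (i < n)%N -> (k, j, i) \in s) -> kap != 0 ->
  wmeasurable c -> (forall i, wmeasurable (u i)) ->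
  (forall i w t, c (upd w (k, j, i) t) = c w) ->
  (forall i' i w t, u i' (upd w (k, j, i) t) = u i' w) ->
  gae s (fun w => c w + kap * \sum_(i < n) W w k j i * u i w = 0 ->
    forall i, (i < n)%N -> u i w = 0).
Proof.
move=> ks kap0 mc mu cE uE.
pose a w := c w + kap * \sum_(i < n) W w k j i * u i w.
have ma : wmeasurable a.
  apply: wmeasurableD => //; apply: wmeasurableM; first exact: wmeasurable_cst.
  by apply: wmeasurable_sum => i; apply: wmeasurableM => //; exact: wmeasurable_W.
suff : gae s (fun w => forall i, (i < n)%N -> a w = 0 -> kap * u i w = 0).
  apply: gae_impl => w H aw0 i ilt; have /eqP := H i ilt aw0.
  by rewrite mulf_eq0 (negbTE kap0) => /eqP.
apply: gae_ord => i ilt; apply: (gae_affine (ks i ilt)) => //.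
- by apply: wmeasurableM => //; exact: wmeasurable_cst.
- move=> w t; rewrite /a cE -addrA; congr (_ + _).
  rewrite (bigD1 (Ordinal ilt))//= [in RHS](bigD1 (Ordinal ilt))//=.
  rewrite W_upd eqxx uE (eq_bigr (fun i0 : 'I_n => W w k j i0 * u i0 w)); last first.
    move=> i' ii'; rewrite uE W_upd !xpair_eqE !eqxx /=.
    by have -> : (i' == i :> nat) = false by apply/negbTE.
  by rewrite /W; ring.
- by move=> w t; rewrite uE.
Qed.

End networks_common.

(** * ResNets *)

Section resnet.
Context {R : realType} (A : resnet_arch) (alpha : nat -> R) (x : nat -> R).
Implicit Types (w : weights R) (z : nat * nat * nat -> bool).

(* The network in which the ReLU of neuron [v] is replaced by multiplication by
   the free gate [z v]; as in [rn_y], [d] is the block whose skip connection is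
   removed. *)
Fixpoint rn_gbranch w z (l : nat) (yprev : nat -> R) (h : nat) : nat -> R :=
  match h with
  | 0 => yprev
  | h'.+1 => fun j => isq R (rdim A l h') *
      \sum_(i < rdim A l h') W w (Wmid l h'.+1) j i *
        (if h' == 0%N then rn_gbranch w z l yprev h' i
         else sq2 R * (if z (l, h', i : nat) then rn_gbranch w z l yprev h' i else 0))
  end.

Fixpoint rn_gy w z (d l : nat) : nat -> R :=
  match l with
  | 0 => fun j => isq R (rn_n0 A) * \sum_(i < rn_n0 A) W w Win j i * x i
  | l'.+1 => fun j =>
      (if l'.+1 == d then 0 else rn_gy w z d l' j)
      + Num.sqrt (alpha l'.+1) * rn_gbranch w z l'.+1 (rn_gy w z d l') (rn_mb A) j
  end.

Definition rn_gout w z d : R :=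
  isq R (rn_n A) * \sum_(j < rn_n A) W w Wout 0 j * rn_gy w z d (rn_L A) j.

(** Lexicographic order of block and depth, the depth being at most [rn_mb A]. *)
Definition rn_rank (v : nat * nat * nat) : nat := (v.1.1 * (rn_mb A).+1 + v.1.2)%N.

(** The depths stop before [rn_mb A] because neither the end of a branch nor [y^l] is followed by a
    ReLU. *)
Definition rn_neurons : seq (nat * nat * nat) :=
  sort (relpre rn_rank leq) (undup
    (flatten [seq flatten [seq [seq (l, h, i) | i <- iota 0 (rdim A l h)]
                          | h <- iota 1 (rn_mb A).-1] | l <- iota 1 (rn_L A)])).

Lemma mem_rn_neurons l h i : ((l, h, i) \in rn_neurons) =
  [&& (1 <= l <= rn_L A)%N, (1 <= h < rn_mb A)%N & (i < rdim A l h)%N].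
Proof.
rewrite mem_sort mem_undup; apply/idP/idP.
  move=> /flatten_mapP[l']; rewrite mem_iota => l'L /flatten_mapP[h'].
  rewrite mem_iota => h'm /mapP[i']; rewrite mem_iota => i'n [-> -> ->].
  by move: l'L h'm i'n; lia.
move=> /and3P[lL hm ilt]; apply/flatten_mapP; exists l; first by rewrite mem_iota; lia.
apply/flatten_mapP; exists h; first by rewrite mem_iota; lia.
by apply/mapP; exists i => //; rewrite mem_iota; lia.
Qed.

Lemma rn_neurons_uniq : uniq rn_neurons.
Proof. by rewrite sort_uniq undup_uniq. Qed.

Lemma rn_neurons_sorted : sorted (relpre rn_rank leq) rn_neurons.
Proof. by apply: sort_sorted => u v; exact: leq_total. Qed.

Definition rn_pre d w (v : nat * nat * nat) : R :=
  rn_branch A w v.1.1 (rn_y A alpha w x d v.1.1.-1) v.1.2 v.2.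

Definition rn_gpre d w z (v : nat * nat * nat) : R :=
  rn_gbranch w z v.1.1 (rn_gy w z d v.1.1.-1) v.1.2 v.2.

(* Gauge transformation: each weight is multiplied by the signs of the ReLU
   neurons at its two ends. *)
Definition rn_sigma (e : nat * nat * nat -> bool) (k : wkey) : bool :=
  let sg v := (v \in rn_neurons) && e v in
  match k with
  | (Wmid l h, j, i) => sg (l, h, j) (+) sg (l, h.-1, i)
  | _ => false
  end.

(** * ResNets and their path sums as gated networks *)

Lemma rn_branchE w z l yp h :
  (forall h' i, (0 < h' < h)%N -> (i < rdim A l h')%N ->
     z (l, h', i) = (0 < rn_branch A w l yp h' i)) ->
  rn_branch A w l yp h = rn_gbranch w z l yp h.
Proof.
elim: h => //= h IH zE; apply/funext => j; congr (_ * _).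
apply: eq_bigr => i _; congr (_ * _); rewrite -IH => [|h' i' /andP[h0 hh]]; last first.
  by apply: zE; rewrite h0 ltnW.
by case: eqVneq => // h0; rewrite reluE -zE// lt0n h0 /=.
Qed.

Lemma rn_yE w z d l :
  (forall l' h' i, (0 < l' <= l)%N -> (0 < h' < rn_mb A)%N -> (i < rdim A l' h')%N ->
     z (l', h', i) = (0 < rn_pre d w (l', h', i))) ->
  rn_y A alpha w x d l = rn_gy w z d l.
Proof.
elim: l => //= l IH zE; rewrite -IH; last first.
  by move=> l' h' i /andP[l0 ll]; apply: zE; rewrite l0 leqW.
apply/funext => j; congr (_ + _ * _).
rewrite (@rn_branchE _ z)// => h' i hh ilt.
by rewrite zE// ltnS leqnn.
Qed.

Lemma rn_psbranch1 w z l yp PA PB k h :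
  (forall h' i, (0 < h' < h)%N -> (i < rdim A l h')%N ->
     z (l, h', i) = (0 < rn_branch A w l yp h' i)) ->
  (rn_psbranch A w l yp PA PB k h).1 = rn_gbranch w z l PA h.
Proof.
elim: h => //= h IH zE; apply/funext => j; congr (_ * _).
apply: eq_bigr => i _; rewrite -mulrA IH => [|h' i' /andP[h0 hh]]; last first.
  by apply: zE; rewrite h0 ltnW.
congr (_ * _); case: eqVneq => h0; first by rewrite mul1r.
rewrite -mulrA /gate -zE//; last by rewrite lt0n h0 /=.
by case: ifP; rewrite ?mul1r ?mul0r.
Qed.

Lemma rn_psbranch2_out w z l yp PA PB k h :
  (forall h' i, (0 < h' < h)%N -> (i < rdim A l h')%N ->
     z (l, h', i) = (0 < rn_branch A w l yp h' i)) ->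
  (forall h', k != Wmid l h') ->
  (rn_psbranch A w l yp PA PB k h).2 = rn_gbranch w z l PB h.
Proof.
move=> zE kl; elim: h zE => //= h IH zE; apply/funext => j; congr (_ * _).
apply: eq_bigr => i _; rewrite (negbTE (kl _)) -mulrA IH => [|h' i' /andP[h0 hh]]; last first.
  by apply: zE; rewrite h0 ltnW.
congr (_ * _); case: eqVneq => h0; first by rewrite mul1r.
rewrite -mulrA /gate -zE//; last by rewrite lt0n h0 /=.
by case: ifP; rewrite ?mul1r ?mul0r.
Qed.

(** Every path through the branch to a depth at least [hk] crosses [W^{l,hk}], so all paths [PA]
    entering the block are counted. *)
Lemma rn_psbranch2_in w z l yp PA PB hk h :
  (forall h' i, (0 < h' < h)%N -> (i < rdim A l h')%N ->
     z (l, h', i) = (0 < rn_branch A w l yp h' i)) ->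
  (0 < hk <= h)%N ->
  (rn_psbranch A w l yp PA PB (Wmid l hk) h).2 = rn_gbranch w z l PA h.
Proof.
elim: h => [|h IH] zE /andP[hk0 hkh]; first by move: hk0 hkh; lia.
have zE' h' i : (0 < h' < h)%N -> (i < rdim A l h')%N ->
     z (l, h', i) = (0 < rn_branch A w l yp h' i).
  by move=> /andP[h0 hh]; apply: zE; rewrite h0 ltnW.
apply/funext => j /=; congr (_ * _); apply: eq_bigr => i _; rewrite -mulrA; congr (_ * _).
have -> : (if Wmid l hk == Wmid l h.+1 then (rn_psbranch A w l yp PA PB (Wmid l hk) h).1 i
    else (rn_psbranch A w l yp PA PB (Wmid l hk) h).2 i) = rn_gbranch w z l PA h i.
  rewrite Wmid_eq eqxx /=; case: eqVneq => hkE; first by rewrite (rn_psbranch1 _ _ _ zE').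
  by rewrite (IH zE')// hk0 -ltnS ltn_neqAle hkE.
case: eqVneq => h0; first by rewrite mul1r.
rewrite -mulrA /gate -zE//; last by rewrite lt0n h0 /=.
by case: ifP; rewrite ?mul1r ?mul0r.
Qed.

Lemma rn_gbranch0 w z l h : rn_gbranch w z l (fun _ => 0) h = fun _ => 0.
Proof.
elim: h => //= h ->; apply/funext => j; rewrite big1 ?mulr0// => i _.
by rewrite !if_same !mulr0 if_same mulr0.
Qed.

Lemma rn_gy_drop w z d l : (l < d)%N -> rn_gy w z d l = rn_gy w z 0 l.
Proof.
elim: l => //= l IH ld; rewrite IH//; last exact: ltnW.
by rewrite ltn_eqF.
Qed.

Lemma rn_ps1 w z k l :
  (forall l' h' i, (0 < l' <= l)%N -> (0 < h' < rn_mb A)%N -> (i < rdim A l' h')%N ->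
     z (l', h', i) = (0 < rn_pre 0 w (l', h', i))) ->
  (rn_ps A alpha w x k l).1 = rn_gy w z 0 l.
Proof.
elim: l => //= l IH zE; apply/funext => j; rewrite IH; last first.
  by move=> l' h' i /andP[l0 ll]; apply: zE; rewrite l0 leqW.
congr (_ + _ * _); rewrite (@rn_psbranch1 _ z)// => h' i hh ilt.
by rewrite zE// ltnS leqnn.
Qed.

(** Before block [lk] no path has met $W^k$. At that block the skip connection therefore contributes
    0 while the branch carries all paths, which is the recursion with this skip removed; later
    blocks are linear once the gates are fixed. *)
Lemma rn_ps2 w z lk hk l :
  (forall l' h' i, (0 < l' <= l)%N -> (0 < h' < rn_mb A)%N -> (i < rdim A l' h')%N ->
     z (l', h', i) = (0 < rn_pre 0 w (l', h', i))) ->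
  (0 < lk)%N -> (0 < hk <= rn_mb A)%N ->
  (rn_ps A alpha w x (Wmid lk hk) l).2 =
    if (l < lk)%N then fun _ => 0 else rn_gy w z lk l.
Proof.
move=> + lk0 hkm; elim: l => [|l IH] zE; first by rewrite lk0.
have zE' l' h' i : (0 < l' <= l)%N -> (0 < h' < rn_mb A)%N -> (i < rdim A l' h')%N ->
     z (l', h', i) = (0 < rn_pre 0 w (l', h', i)).
  by move=> /andP[l0 ll]; apply: zE; rewrite l0 leqW.
have zl h' i : (0 < h' < rn_mb A)%N -> (i < rdim A l.+1 h')%N ->
    z (l.+1, h', i) = (0 < rn_branch A w l.+1 (rn_y A alpha w x 0 l) h' i).
  by move=> hh ilt; rewrite zE// ltnS leqnn.
rewrite /= IH// (rn_ps1 _ zE').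
have [lE|lNE] := eqVneq l.+1 lk.
  rewrite -lE ltnSn ltnn (rn_psbranch2_in _ _ zl)//.
  by apply/funext => j; rewrite (rn_gy_drop _ _ (ltnSn l)).
rewrite (@rn_psbranch2_out _ _ _ _ _ _ _ _ zl); last first.
  by move=> h'; rewrite Wmid_eq eq_sym (negbTE lNE).
case: (ltnP l lk) => llk; last first.
  by rewrite ltnNge leqW//=.
rewrite ltn_neqAle lNE llk rn_gbranch0.
by apply/funext => j; rewrite mulr0 addr0.
Qed.

Lemma rn_ps2_win w l : (rn_ps A alpha w x Win l).2 = (rn_ps A alpha w x Win l).1.
Proof.
elim: l => [|l IH]; first by apply/funext.
apply/funext => j /=; rewrite IH; congr (_ + _ * _).
pose z (v : nat * nat * nat) := 0 < rn_branch A w v.1.1 (rn_y A alpha w x 0 l) v.1.2 v.2.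
by rewrite (@rn_psbranch2_out _ z)// (@rn_psbranch1 _ z).
Qed.

Lemma rn_fk_endpoints w k : (if k is Wmid _ _ then false else true) ->
  rn_fk A alpha w x k = rn_out A alpha w x 0.
Proof.
pose z := fun v => 0 < rn_pre 0 w v.
have E k' : (rn_ps A alpha w x k' (rn_L A)).1 = rn_y A alpha w x 0 (rn_L A).
  by rewrite (@rn_ps1 _ z)// (@rn_yE _ z).
case: k => // _; rewrite /rn_fk /rn_out; congr (_ * _); apply: eq_bigr => j _;
  congr (_ * _); last by rewrite E.
by rewrite rn_ps2_win E.
Qed.

Definition rn_gates d w v := (v \in rn_neurons) && (0 < rn_pre d w v).

Lemma rn_gatesE d w l h i : (0 < l <= rn_L A)%N -> (0 < h < rn_mb A)%N ->
  (i < rdim A l h)%N -> rn_gates d w (l, h, i) = (0 < rn_pre d w (l, h, i)).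
Proof. by move=> ll hh ii; rewrite /rn_gates mem_rn_neurons ll hh ii. Qed.

Lemma rn_outE d w : rn_out A alpha w x d = rn_gout w (rn_gates d w) d.
Proof.
rewrite /rn_out /rn_gout (@rn_yE _ (rn_gates d w))// => l h i ll hh ii.
exact: rn_gatesE.
Qed.

(** The same gated network as [rn_outE] gives for the reduced network, but with the gates of the
    full one: what remains is to exchange the gates. *)
Lemma rn_fkE w lk hk : (0 < lk <= rn_L A)%N -> (0 < hk <= rn_mb A)%N ->
  rn_fk A alpha w x (Wmid lk hk) = rn_gout w (rn_gates 0 w) lk.
Proof.
move=> /andP[lk0 lkL] hkm; rewrite /rn_fk /rn_gout /=.
rewrite (@rn_ps2 _ (rn_gates 0 w))//; last by move=> l h i ll hh ii; exact: rn_gatesE.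
by rewrite ltnNge lkL.
Qed.

Lemma rn_gpreE d w v : v \in rn_neurons -> rn_gpre d w (rn_gates d w) v = rn_pre d w v.
Proof.
case: v => -[l h] i; rewrite mem_rn_neurons => /and3P[/andP[l0 ll] /andP[h0 hh] _].
rewrite /rn_gpre /rn_pre /= -rn_yE => [|l' h' i' /andP[l'0 ll'] h'm ii]; last first.
  by apply: rn_gatesE => //; move: l'0 ll' ll l0; lia.
rewrite -rn_branchE// => h' i' /andP[h'0 h'h] ii.
by rewrite rn_gatesE ?l0 ?h'0//= (ltn_trans h'h).
Qed.

(** * Gauge covariance of gated ResNets *)

Let sg (e : nat * nat * nat -> bool) v : R := (-1) ^+ ((v \in rn_neurons) && e v).

Let sgK e v : sg e v * sg e v = 1.
Proof. by rewrite /sg -signr_addb addbb. Qed.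

(** The sign of an inner neuron enters through its incoming and its outgoing weight and squares to
    1; only the sign at the end survives. *)
Lemma rn_gbranch_gauge e w z l yp h j :
  rn_gbranch (wflip (rn_sigma e) w) z l yp h j = sg e (l, h, j) * rn_gbranch w z l yp h j.
Proof.
elim: h j => [|h IH] j /=.
  by rewrite /sg mem_rn_neurons !andbF /= expr0 mul1r.
rewrite [RHS]mulrCA; congr (_ * _); rewrite big_distrr /=; apply: eq_bigr => i _.
rewrite IH {1}/W /wflip /rn_sigma signr_addb /= -/(sg e (l, h.+1, j)) -/(sg e (l, h, i : nat)).
rewrite -!mulrA; congr (_ * _); rewrite mulrCA; congr (_ * _).
case: ifP => _; first by rewrite mulrA sgK mul1r.
by case: ifP => _; rewrite ?mulr0// mulrCA [X in _ * X]mulrA sgK mul1r.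
Qed.

Lemma rn_gy_gauge e w z d l : rn_gy (wflip (rn_sigma e) w) z d l = rn_gy w z d l.
Proof.
elim: l => [|l IH]; apply/funext => j /=.
  by congr (_ * _); apply: eq_bigr => i _; rewrite /W /wflip /= expr0 mul1r.
rewrite IH rn_gbranch_gauge /sg mem_rn_neurons; congr (_ + _ * _).
by rewrite ltnn !andbF /= expr0 mul1r.
Qed.

Lemma rn_gpre_gauge d e w z v : v \in rn_neurons ->
  rn_gpre d (wflip (rn_sigma e) w) z v = (-1) ^+ e v * rn_gpre d w z v.
Proof.
by move=> vN; rewrite /rn_gpre rn_gy_gauge rn_gbranch_gauge -!surjective_pairing /sg vN.
Qed.

Lemma rn_gout_gauge d e w z : rn_gout (wflip (rn_sigma e) w) z d = rn_gout w z d.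
Proof.
rewrite /rn_gout rn_gy_gauge; congr (_ * _); apply: eq_bigr => j _.
by rewrite /W /wflip /= expr0 mul1r.
Qed.

(** * Dependence on the gates *)

Lemma eq_rn_gbranch w z z' l yp h :
  (forall h' i, (0 < h' < h)%N -> z (l, h', i) = z' (l, h', i)) ->
  rn_gbranch w z l yp h = rn_gbranch w z' l yp h.
Proof.
elim: h => //= h IH zz'; rewrite IH => [|h' i /andP[h0 hh]]; last first.
  by apply: zz'; rewrite h0 ltnW.
apply/funext => j; congr (_ * _); apply: eq_bigr => i _; congr (_ * _).
by case: eqVneq => // h0; rewrite zz'// lt0n h0 /=.
Qed.

Lemma eq_rn_gy w z z' d l :
  (forall l' h' i, (0 < l' <= l)%N -> (h' < rn_mb A)%N -> z (l', h', i) = z' (l', h', i)) ->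
  rn_gy w z d l = rn_gy w z' d l.
Proof.
elim: l => //= l IH zz'; rewrite IH => [|l' h' i /andP[l0 ll]]; last first.
  by apply: zz'; rewrite l0 leqW.
rewrite (@eq_rn_gbranch _ _ z')// => h' i /andP[h0 hh].
by rewrite zz'// ltnS leqnn.
Qed.

Lemma rn_gpre_local d w z z' v :
  (forall u, (rn_rank u < rn_rank v)%N -> z u = z' u) ->
  rn_gpre d w z v = rn_gpre d w z' v.
Proof.
case: v => -[l h] i zz'; rewrite /rn_gpre /=.
rewrite (@eq_rn_gy _ z z') => [|l' h' i' /andP[l0 ll] hm].
  rewrite (@eq_rn_gbranch _ z z')// => h' i' /andP[h0 hh].
  by apply: zz'; rewrite /rn_rank /= ltn_add2l.
apply: zz'; rewrite /rn_rank /=.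
(* All ranks of block [l'] lie below the multiple of [(rn_mb A).+1] at which the next block
   starts. *)
apply: (@leq_trans (l'.+1 * (rn_mb A).+1)); first by rewrite mulSn; lia.
by rewrite (leq_trans _ (leq_addr _ _))// leq_mul2r; lia.
Qed.

Lemma rn_gbranch_setg_neq w z v b l yp h : l != v.1.1 ->
  rn_gbranch w (setg z v b) l yp h = rn_gbranch w z l yp h.
Proof.
move=> lv; apply: eq_rn_gbranch => h' i _; rewrite /setg; case: eqVneq => // vE.
by move: lv; rewrite -vE eqxx.
Qed.

Lemma rn_gbranch_setg w z l yp h i b h' : rn_gbranch w z l yp h i = 0 ->
  rn_gbranch w (setg z (l, h, i) b) l yp h' = rn_gbranch w z l yp h'.
Proof.
move=> g0; elim: h' => //= h' IH; apply/funext => j; congr (_ * _).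
apply: eq_bigr => i' _; congr (_ * _); rewrite IH; case: ifP => // _; congr (_ * _).
by rewrite /setg; move: (nat_of_ord i') => n; case: eqP => // -[-> ->]; rewrite g0 !if_same.
Qed.

Lemma rn_gout_setg d w z v b : rn_gpre d w z v = 0 ->
  rn_gout w (setg z v b) d = rn_gout w z d.
Proof.
move=> g0; suff E l : rn_gy w (setg z v b) d l = rn_gy w z d l by rewrite /rn_gout E.
elim: l => //= l ->; apply/funext => j; congr (_ + _ * _).
have [lv|lv] := eqVneq l.+1 v.1.1; last by rewrite rn_gbranch_setg_neq.
move: v lv g0 => [[l' h] i] /= <-; rewrite /rn_gpre /= => g0.
by rewrite rn_gbranch_setg.
Qed.

(** * Measurability of ResNet quantities *)

Lemma wmeasurable_rn_gbranch z l (yp : weights R -> nat -> R) h j :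
  (forall j, wmeasurable (yp ^~ j)) ->
  wmeasurable (fun w => rn_gbranch w z l (yp w) h j).
Proof.
move=> myp; elim: h j => //= h IH j.
apply: wmeasurableM; first exact: wmeasurable_cst.
apply: wmeasurable_sum => i; apply: wmeasurableM; first exact: wmeasurable_W.
case: (h == 0%N) => //; apply: wmeasurableM; first exact: wmeasurable_cst.
by case: (z _) => //; exact: wmeasurable_cst.
Qed.

Lemma wmeasurable_rn_gy z d l j : wmeasurable (fun w => rn_gy w z d l j).
Proof.
elim: l j => /= [|l IH] j.
  apply: wmeasurableM; first exact: wmeasurable_cst.
  by apply: wmeasurable_sum => i; apply: wmeasurableM;
    [exact: wmeasurable_W|exact: wmeasurable_cst].
apply: wmeasurableD; first by case: (l.+1 == d) => //; exact: wmeasurable_cst.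
apply: wmeasurableM; first exact: wmeasurable_cst.
exact: (@wmeasurable_rn_gbranch z l.+1 (fun w => rn_gy w z d l)).
Qed.

Lemma wmeasurable_rn_gout z d : wmeasurable (fun w => rn_gout w z d).
Proof.
apply: wmeasurableM; first exact: wmeasurable_cst.
by apply: wmeasurable_sum => i; apply: wmeasurableM;
  [exact: wmeasurable_W|exact: wmeasurable_rn_gy].
Qed.

Lemma wmeasurable_rn_branch l (yp : weights R -> nat -> R) h j :
  (forall j, wmeasurable (yp ^~ j)) ->
  wmeasurable (fun w => rn_branch A w l (yp w) h j).
Proof.
move=> myp; elim: h j => //= h IH j.
apply: wmeasurableM; first exact: wmeasurable_cst.
apply: wmeasurable_sum => i; apply: wmeasurableM; first exact: wmeasurable_W.
case: (h == 0%N) => //; apply: wmeasurableM; first exact: wmeasurable_cst.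
exact: wmeasurable_relu.
Qed.

Lemma wmeasurable_rn_y d l j : wmeasurable (fun w => rn_y A alpha w x d l j).
Proof.
elim: l j => /= [|l IH] j.
  apply: wmeasurableM; first exact: wmeasurable_cst.
  by apply: wmeasurable_sum => i; apply: wmeasurableM;
    [exact: wmeasurable_W|exact: wmeasurable_cst].
apply: wmeasurableD; first by case: (l.+1 == d) => //; exact: wmeasurable_cst.
apply: wmeasurableM; first exact: wmeasurable_cst.
exact: (@wmeasurable_rn_branch l.+1 (fun w => rn_y A alpha w x d l)).
Qed.

Lemma wmeasurable_rn_out d : wmeasurable (fun w => rn_out A alpha w x d).
Proof.
apply: wmeasurableM; first exact: wmeasurable_cst.
by apply: wmeasurable_sum => i; apply: wmeasurableM;
  [exact: wmeasurable_W|exact: wmeasurable_rn_y].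
Qed.

Lemma wmeasurable_rn_psbranch l (yp PA PB : weights R -> nat -> R) k h :
  (forall j, wmeasurable (yp ^~ j)) -> (forall j, wmeasurable (PA ^~ j)) ->
  (forall j, wmeasurable (PB ^~ j)) ->
  (forall j, wmeasurable (fun w => (rn_psbranch A w l (yp w) (PA w) (PB w) k h).1 j)) /\
  (forall j, wmeasurable (fun w => (rn_psbranch A w l (yp w) (PA w) (PB w) k h).2 j)).
Proof.
move=> myp mA mB; elim: h => //= h [IH1 IH2].
have mg (i : nat) : wmeasurable (fun w => if h == 0%N then 1
    else sq2 R * gate (rn_branch A w l (yp w) h i)).
  case: (h == 0%N); first exact: wmeasurable_cst.
  apply: wmeasurableM; first exact: wmeasurable_cst.
  by apply: wmeasurable_gate; exact: wmeasurable_rn_branch.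
split=> j; (apply: wmeasurableM; first exact: wmeasurable_cst);
  apply: wmeasurable_sum => i; apply: wmeasurableM => //;
  try (by apply: wmeasurableM => //; exact: wmeasurable_W).
by case: (k == _).
Qed.

Lemma wmeasurable_rn_ps k l :
  (forall j, wmeasurable (fun w => (rn_ps A alpha w x k l).1 j)) /\
  (forall j, wmeasurable (fun w => (rn_ps A alpha w x k l).2 j)).
Proof.
elim: l => /= [|l [IH1 IH2]].
  have m0 j : wmeasurable (fun w : weights R =>
      isq R (rn_n0 A) * \sum_(i < rn_n0 A) W w Win j i * x i).
    apply: wmeasurableM; first exact: wmeasurable_cst.
    by apply: wmeasurable_sum => i; apply: wmeasurableM;
      [exact: wmeasurable_W|exact: wmeasurable_cst].
  by split=> j //; case: (k == _) => //; exact: wmeasurable_cst.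
have [m1 m2] := wmeasurable_rn_psbranch l.+1 k (rn_mb A)
  (@wmeasurable_rn_y 0 l) IH1 IH2.
by split=> j; apply: wmeasurableD => //; apply: wmeasurableM => //;
  exact: wmeasurable_cst.
Qed.

Lemma wmeasurable_rn_fk k : wmeasurable (fun w => rn_fk A alpha w x k).
Proof.
have [m1 m2] := wmeasurable_rn_ps k (rn_L A).
apply: wmeasurableM; first exact: wmeasurable_cst.
apply: wmeasurable_sum => i; apply: wmeasurableM; first exact: wmeasurable_W.
by case: (k == _).
Qed.

End resnet.

(** * Generic nonvanishing and the moments of ResNets *)

Section resnet_moments.
Context {R : realType} (A : resnet_arch) (alpha : nat -> R) (x : nat -> R).
Implicit Types (w : weights R) (z : nat * nat * nat -> bool).
Hypothesis mb_gt0 : (0 < rn_mb A)%N.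
Hypothesis n_gt0 : (0 < rn_n A)%N.
Hypothesis d_gt0 : forall l h,
  (1 <= l <= rn_L A)%N -> (1 <= h < rn_mb A)%N -> (0 < rn_d A l h)%N.
Hypothesis alpha_gt0 : forall l, (1 <= l <= rn_L A)%N -> 0 < alpha l.
Hypothesis x_norm : Num.sqrt (\sum_(i < rn_n0 A) x i ^+ 2) = 1.

Local Notation gb := (rn_gbranch A).
Local Notation gy := (rn_gy A alpha x).
Local Notation gpre := (rn_gpre A alpha x).

Lemma rdim_gt0 l h : (0 < l <= rn_L A)%N -> (h < rn_mb A)%N -> (0 < rdim A l h)%N.
Proof.
move=> ll hm; rewrite /rdim; case: eqVneq => // h0; case: eqVneq => // _.
by apply: d_gt0 => //; rewrite lt0n h0.
Qed.

Lemma mem_rn_keys l h j i : (0 < l <= rn_L A)%N -> (0 < h <= rn_mb A)%N ->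
  (j < rdim A l h)%N -> (i < rdim A l h.-1)%N -> (Wmid l h, j, i) \in rn_keys A.
Proof.
move=> ll hm jn il; rewrite !mem_cat; apply/orP; right; apply/orP; left.
apply/flatten_mapP; exists l; first by rewrite mem_iota; lia.
apply/flatten_mapP; exists h; first by rewrite mem_iota; lia.
exact: mem_mat_keys.
Qed.

Lemma mem_rn_keys_win j i : (j < rn_n A)%N -> (i < rn_n0 A)%N ->
  (Win, j, i) \in rn_keys A.
Proof. by move=> jn il; rewrite !mem_cat mem_mat_keys. Qed.

Lemma x_neq0 : exists2 i, (i < rn_n0 A)%N & x i != 0.
Proof.
apply: contrapT => H; move: x_norm; rewrite big1 ?sqrtr0.
  by move/eqP; rewrite eq_sym oner_eq0.
move=> i _; apply/eqP; rewrite sqrf_eq0; apply/negPn/negP => xi.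
by apply: H; exists i.
Qed.

Lemma rn_gbranch_upd w z l yp h l' h' j i t : (l != l') || (h < h')%N ->
  gb (upd w (Wmid l' h', j, i) t) z l yp h = gb w z l yp h.
Proof.
elim: h => //= h IH H; rewrite IH; last first.
  by case/orP: H => [->//|hh]; rewrite (ltnW hh) orbT.
apply/funext => j'; congr (_ * _); apply: eq_bigr => i' _.
rewrite W_upd_neq// Wmid_eq negb_and; case/orP: H => [->//|hh].
by rewrite (ltn_eqF hh) orbT.
Qed.

Lemma rn_gy_upd w z d l l' h' j i t : (l < l')%N ->
  gy (upd w (Wmid l' h', j, i) t) z d l = gy w z d l.
Proof.
elim: l => [//|l IH] ll /=.
by rewrite IH ?(ltnW ll)// rn_gbranch_upd// (ltn_eqF ll).
Qed.

Definition rn_gact w z l yp h (i : nat) : R :=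
  if h == 0%N then gb w z l yp h i
  else sq2 R * (if z (l, h, i) then gb w z l yp h i else 0).

Lemma rn_gbranchS w z l yp h j : gb w z l yp h.+1 j =
  isq R (rdim A l h) *
    \sum_(i < rdim A l h) W w (Wmid l h.+1) j i * rn_gact w z l yp h i.
Proof. by []. Qed.

Lemma wmeasurable_rn_gact z d l h i :
  wmeasurable (fun w => rn_gact w z l (gy w z d l.-1) h i).
Proof.
have mg j : wmeasurable (fun w => gb w z l (gy w z d l.-1) h j).
  by apply: (@wmeasurable_rn_gbranch R A z l (fun w => gy w z d l.-1)) => j';
    exact: wmeasurable_rn_gy.
rewrite /rn_gact; case: (h == 0%N) => //.
apply: wmeasurableM; first exact: wmeasurable_cst.
by case: (z _) => //; exact: wmeasurable_cst.
Qed.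

Lemma rn_gact_upd w z d l h i j i' t : (0 < l)%N ->
  rn_gact (upd w (Wmid l h.+1, j, i') t) z l
    (gy (upd w (Wmid l h.+1, j, i') t) z d l.-1) h i =
  rn_gact w z l (gy w z d l.-1) h i.
Proof.
move=> l0; rewrite /rn_gact rn_gy_upd; last by rewrite prednK.
by rewrite rn_gbranch_upd// ltnSn orbT.
Qed.

(** The skip connection prevents collapse. If [y^l_j] vanished, the fresh row of the last branch
    matrix would force all its inputs to vanish; the branch term would then be 0 and leave
    [y^{l-1}_j = 0]. The induction starts from a nonzero entry of [x]. *)
Lemma rn_gy_neq0 z l j : (l <= rn_L A)%N -> (j < rn_n A)%N ->
  gae (rn_keys A) (fun w => gy w z 0 l j != 0).
Proof.
elim: l => [|l IH] lL jn.
  have [i0 i0n xi0] := x_neq0.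
  have n0_gt0 : (0 < rn_n0 A)%N by exact: leq_ltn_trans i0n.
  have := @gae_row R (rn_keys A) Win j (rn_n0 A) (isq R (rn_n0 A)) (fun _ => 0)
    (fun i _ => x i).
  case.
  - by move=> i ilt; exact: mem_rn_keys_win.
  - exact: isq_neq0.
  - exact: wmeasurable_cst.
  - by move=> i; exact: wmeasurable_cst.
  - by [].
  - by [].
  move=> H [mH H0 HE HQ]; exists H; split=> // w /HQ Hw; apply/eqP => a0.
  by move/eqP: xi0; apply; apply: Hw => //; rewrite add0r.
have lL' : (0 < l.+1 <= rn_L A)%N by [].
have mbE : rn_mb A = (rn_mb A).-1.+1 by rewrite prednK.
have sa0 : Num.sqrt (alpha l.+1) != 0 by rewrite gt_eqF// sqrtr_gt0 alpha_gt0.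
have := gae_and (IH (ltnW lL) jn) (@gae_row R (rn_keys A) (Wmid l.+1 (rn_mb A)) j
  (rdim A l.+1 (rn_mb A).-1)
  (Num.sqrt (alpha l.+1) * isq R (rdim A l.+1 (rn_mb A).-1))
  (fun w => gy w z 0 l j)
  (fun i w => rn_gact w z l.+1 (gy w z 0 l) (rn_mb A).-1 i) _ _ _ _ _ _).
case.
- move=> i ilt; apply: mem_rn_keys => //; first by rewrite mb_gt0 /=.
  by rewrite /rdim eqxx; case: ifP.
- by rewrite mulf_neq0// isq_neq0// rdim_gt0// ltn_predL.
- exact: wmeasurable_rn_gy.
- by move=> i; exact: (wmeasurable_rn_gact z 0 l.+1).
- by move=> i w t; rewrite rn_gy_upd.
- by move=> i' i w t; have := @rn_gact_upd w z 0 l.+1 (rn_mb A).-1 i' j i t;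
    rewrite -mbE; exact.
move=> H [mH H0 HE HQ]; exists H; split=> // w /HQ[y0 Hw]; apply/eqP => a0.
move/eqP: y0; apply; move: (a0) => /=; rewrite mbE rn_gbranchS -mbE mulrA => a0'.
have u0 := Hw a0'.
by move: a0'; rewrite big1 ?mulr0 ?addr0// => i _; rewrite u0// mulr0.
Qed.

(* A preactivation of the full network vanishes with positive probability when
   a whole layer is dead, but then no active path reaches the neuron. *)
Lemma rn_gpre_deg z d v : v \in rn_neurons A ->
  gae (rn_keys A) (fun w => gpre 0 w z v = 0 -> gpre d w z v = 0).
Proof.
case: v => -[l h] j; rewrite mem_rn_neurons => /and3P[ll hm jn].
have l0 : (0 < l)%N by case/andP: ll.
elim: h hm j jn => [//|h IH] hm j jn.
have hm' : (h < rn_mb A)%N by case/andP: hm => _ /ltnW.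
have row : gae (rn_keys A) (fun w => gpre 0 w z (l, h.+1, j) = 0 ->
    forall i, (i < rdim A l h)%N -> rn_gact w z l (gy w z 0 l.-1) h i = 0).
  have := @gae_row R (rn_keys A) (Wmid l h.+1) j (rdim A l h) (isq R (rdim A l h))
    (fun _ => 0) (fun i w => rn_gact w z l (gy w z 0 l.-1) h i).
  case.
  - by move=> i ilt; apply: mem_rn_keys.
  - by rewrite isq_neq0// rdim_gt0.
  - exact: wmeasurable_cst.
  - by move=> i; exact: wmeasurable_rn_gact.
  - by [].
  - by move=> i' i w t; exact: rn_gact_upd.
  move=> H [mH H0 HE HQ]; exists H; split=> // w /HQ Hw a0; apply: Hw.
  by rewrite add0r.
(* At the first depth the inputs are the entries of [y^{l-1}], almost surely nonzero, so the
   preactivation cannot vanish. *)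
have [hE|h0] := eqVneq h 0%N.
  have lL : (l.-1 <= rn_L A)%N by move: ll; lia.
  have := gae_and row (rn_gy_neq0 z lL n_gt0); apply: gae_impl => w [H y0] /H {}H.
  by move: y0; have := H 0%N; rewrite /rn_gact hE /= => ->; rewrite ?eqxx// rdim_gt0.
have hm2 : (1 <= h < rn_mb A)%N by rewrite lt0n h0.
(* Deeper in the branch, an active neuron one layer below has zero preactivation in the full
   network, hence by induction in the network [d]. *)
have : gae (rn_keys A) (fun w => forall i, (i < rdim A l h)%N ->
    gpre 0 w z (l, h, i) = 0 -> gpre d w z (l, h, i) = 0).
  by apply: gae_ord => i ilt; exact: IH.
move=> /(gae_and row); apply: gae_impl => w [H Hd] /H {}H.
rewrite /rn_gpre rn_gbranchS big1 ?mulr0//= => i _.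
have := H i (ltn_ord i); rewrite /rn_gact (negbTE h0).
case: ifP => _; last by rewrite !mulr0.
move/eqP; rewrite mulf_eq0 (negbTE sq2_neq0) => /eqP a0.
by have := Hd i (ltn_ord i) a0; rewrite /rn_gpre /= => ->; rewrite !mulr0.
Qed.

Lemma rn_moments m k : ~~ odd m -> rn_valid A k ->
  Emom (rn_keys A) (fun w => rn_reduced A alpha w x k) m
  = Emom (rn_keys A) (fun w => rn_fk A alpha w x k) m.
Proof.
move=> em; case: k => [_|lk hk kv|_].
- by congr Emom; apply/funext => w; rewrite rn_fk_endpoints.
- have /andP[lkL hkm] := kv.
  apply: (@asum_cst_inj _ _ (rn_neurons A) (fun _ => false)).
  (* One formula for both sides: the polynomial is always that of the reduced network, while [d]
     selects the network supplying the gates. *)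
  have avg d f : (forall w, f w = rn_gout A alpha x w (rn_gates A alpha x d w) lk) ->
      wmeasurable f ->
      (forall z v, v \in rn_neurons A ->
         gae (rn_keys A) (fun w => gpre d w z v = 0 -> gpre lk w z v = 0)) ->
      asum (rn_neurons A) (fun _ => false) (fun _ => Emom (rn_keys A) f m) =
      gexp (rn_keys A) (fun w => asum (rn_neurons A) (fun _ => false)
        (fun z => (rn_gout A alpha x w z lk ^+ m)%:E)).
    move=> fE mf deg.
    apply: (@gauge_average R _ _ _ (rn_rank A) (rn_sigma A) (rn_pre A alpha x d)
      (gpre d) (fun w z => rn_gout A alpha x w z lk)) => //.
    + exact: rn_neurons_uniq.
    + exact: rn_neurons_sorted.
    + by move=> w v; exact: rn_gpreE.
    + by move=> e w z v; exact: rn_gpre_gauge.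
    + by move=> e w z; exact: rn_gout_gauge.
    + by move=> w z z' v; exact: rn_gpre_local.
    + move=> z; have := gae_all (deg z); apply: gae_impl => w H v vN a0 b.
      by apply: rn_gout_setg; exact: H.
    + by move=> z; exact: wmeasurable_rn_gout.
  (* With recomputed gates the degeneracy condition is a tautology; with the gates of the full
     network it is [rn_gpre_deg]. *)
  rewrite (avg lk)//.
  + rewrite (avg 0%N)//.
    * by move=> w; exact: rn_fkE.
    * exact: wmeasurable_rn_fk.
    * by move=> z v; exact: rn_gpre_deg.
  + by move=> w; exact: rn_outE.
  + exact: wmeasurable_rn_out.
  + by move=> z v _; exact: gaeT.
- by congr Emom; apply/funext => w; rewrite rn_fk_endpoints.
Qed.

End resnet_moments.

(** * DenseNets *)

Section densenet.
Context {R : realType} (D : densenet_arch) (alpha : R) (x : nat -> R).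
Implicit Types (w : weights R) (z : nat * nat -> bool) (d : option (nat * nat)).

Fixpoint dn_gtab w z d (l : nat) : nat -> nat -> R :=
  match l with
  | 0 => fun _ j => dn_y0 D w x j
  | l'.+1 =>
      let T := dn_gtab w z d l' in
      let new := fun j => dn_scale D alpha l'.+1 *
         \sum_(h < l'.+1 | dn_conn d l'.+1 h)
            \sum_(i < dn_n D h) W w (Wmid l'.+1 h) j i *
              (sq2 R * (if z (h : nat, i : nat) then T h i else 0)) in
      fun h j => if (h <= l')%N then T h j else new j
  end.

(** Diagonals of the tables: a layer never changes once entered, so the diagonals obey recursions
    over all earlier layers. *)
Definition dn_gy w z d l : nat -> R := dn_gtab w z d l l.
Definition dn_y w d l : nat -> R := dn_tab D alpha w x d l l.
Definition dn_p1 w k l : nat -> R := (dn_ps D alpha w x k l).1 l.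
Definition dn_p2 w k l : nat -> R := (dn_ps D alpha w x k l).2 l.

Lemma dn_gtabE w z d l h : (h <= l)%N -> dn_gtab w z d l h = dn_gy w z d h.
Proof.
elim: l => [|l IH] hl; first by move: hl; rewrite leqn0 => /eqP ->.
have [hl'|lh] := leqP h l; last by have -> : h = l.+1 by apply/eqP; rewrite eqn_leq hl.
by rewrite -IH//; apply/funext => j /=; rewrite hl'.
Qed.

Lemma dn_tabE w d l h : (h <= l)%N -> dn_tab D alpha w x d l h = dn_y w d h.
Proof.
elim: l => [|l IH] hl; first by move: hl; rewrite leqn0 => /eqP ->.
have [hl'|lh] := leqP h l; last by have -> : h = l.+1 by apply/eqP; rewrite eqn_leq hl.
by rewrite -IH//; apply/funext => j /=; rewrite hl'.
Qed.

Lemma dn_psE w k l h : (h <= l)%N ->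
  (dn_ps D alpha w x k l).1 h = dn_p1 w k h /\ (dn_ps D alpha w x k l).2 h = dn_p2 w k h.
Proof.
elim: l => [|l IH] hl; first by move: hl; rewrite leqn0 => /eqP ->.
have [hl'|lh] := leqP h l; last by have -> : h = l.+1 by apply/eqP; rewrite eqn_leq hl.
by have [<- <-] := IH hl'; split; apply/funext => j /=; rewrite hl'.
Qed.

(** A dropped connection counts as a zero term, so that sums for different [d] share their index set
    and compare termwise. *)
Lemma dn_gyS w z d l j : dn_gy w z d l.+1 j = dn_scale D alpha l.+1 *
  \sum_(h < l.+1) if dn_conn d l.+1 h then
    \sum_(i < dn_n D h) W w (Wmid l.+1 h) j i *
      (sq2 R * (if z (h : nat, i : nat) then dn_gy w z d h i else 0)) else 0.
Proof.
rewrite {1}/dn_gy /= ltnn; congr (_ * _); rewrite big_mkcond; apply: eq_bigr => h _.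
by case: ifP => // _; apply: eq_bigr => i _; rewrite dn_gtabE// -ltnS.
Qed.

Lemma dn_yS w d l j : dn_y w d l.+1 j = dn_scale D alpha l.+1 *
  \sum_(h < l.+1) if dn_conn d l.+1 h then
    \sum_(i < dn_n D h) W w (Wmid l.+1 h) j i * (sq2 R * relu (dn_y w d h i)) else 0.
Proof.
rewrite {1}/dn_y /= ltnn; congr (_ * _); rewrite big_mkcond; apply: eq_bigr => h _.
by case: ifP => // _; apply: eq_bigr => i _; rewrite dn_tabE// -ltnS.
Qed.

Lemma dn_p1S w k l j : dn_p1 w k l.+1 j = dn_scale D alpha l.+1 *
  \sum_(h < l.+1) \sum_(i < dn_n D h) W w (Wmid l.+1 h) j i *
    (sq2 R * gate (dn_y w None h i)) * dn_p1 w k h i.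
Proof.
rewrite {1}/dn_p1 /= ltnn; congr (_ * _); apply: eq_bigr => h _.
have hl : (h <= l)%N by rewrite -ltnS.
by apply: eq_bigr => i _; rewrite dn_tabE// (dn_psE w k hl).1.
Qed.

Lemma dn_p2S w k l j : dn_p2 w k l.+1 j = dn_scale D alpha l.+1 *
  \sum_(h < l.+1) \sum_(i < dn_n D h) W w (Wmid l.+1 h) j i *
    (sq2 R * gate (dn_y w None h i)) *
    (if k == Wmid l.+1 h then dn_p1 w k h i else dn_p2 w k h i).
Proof.
rewrite {1}/dn_p2 /= ltnn; congr (_ * _); apply: eq_bigr => h _.
have hl : (h <= l)%N by rewrite -ltnS.
by apply: eq_bigr => i _; rewrite dn_tabE// (dn_psE w k hl).1 (dn_psE w k hl).2.
Qed.

Definition dn_gout w z d : R :=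
  isq R (dn_n D (dn_L D)) *
  \sum_(j < dn_n D (dn_L D)) W w Wout 0 j * dn_gy w z d (dn_L D) j.

Definition dn_rank (v : nat * nat) : nat := v.1.

(** Layer 0 is included, as [y^0] passes through a ReLU; layer [dn_L D] is not, as the output
    projection reads it linearly. *)
Definition dn_neurons : seq (nat * nat) :=
  sort (relpre dn_rank leq) (undup
    (flatten [seq [seq (l, i) | i <- iota 0 (dn_n D l)] | l <- iota 0 (dn_L D)])).

Lemma mem_dn_neurons l i :
  ((l, i) \in dn_neurons) = (l < dn_L D)%N && (i < dn_n D l)%N.
Proof.
rewrite mem_sort mem_undup; apply/idP/idP.
  move=> /flatten_mapP[l']; rewrite mem_iota => l'L /mapP[i'].
  by rewrite mem_iota => i'n [-> ->]; move: l'L i'n; lia.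
move=> /andP[lL ilt]; apply/flatten_mapP; exists l; first by rewrite mem_iota; lia.
by apply/mapP; exists i => //; rewrite mem_iota; lia.
Qed.

Lemma dn_neurons_uniq : uniq dn_neurons.
Proof. by rewrite sort_uniq undup_uniq. Qed.

Lemma dn_neurons_sorted : sorted (relpre dn_rank leq) dn_neurons.
Proof. by apply: sort_sorted => u v; exact: leq_total. Qed.

Definition dn_pre d w (v : nat * nat) : R := dn_y w d v.1 v.2.
Definition dn_gpre d w z (v : nat * nat) : R := dn_gy w z d v.1 v.2.
Definition dn_gates d w v := (v \in dn_neurons) && (0 < dn_pre d w v).

Definition dn_sigma (e : nat * nat -> bool) (k : wkey) : bool :=
  let sg v := (v \in dn_neurons) && e v in
  match k with
  | (Win, j, _) => sg (0%N, j)
  | (Wmid l h, j, i) => sg (l, j) (+) sg (h, i)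
  | (Wout, _, _) => false
  end.

Lemma dn_gatesE d w l i : (l < dn_L D)%N -> (i < dn_n D l)%N ->
  dn_gates d w (l, i) = (0 < dn_y w d l i).
Proof. by move=> ll ii; rewrite /dn_gates mem_dn_neurons ll ii. Qed.

(** * DenseNets and their path sums as gated networks *)

Lemma dn_yE w z d l :
  (forall h i, (h < l)%N -> (i < dn_n D h)%N -> z (h, i) = (0 < dn_y w d h i)) ->
  dn_y w d l = dn_gy w z d l.
Proof.
elim/ltn_ind: l => -[//|l] IH zE; apply/funext => j; rewrite dn_yS dn_gyS.
congr (_ * _); apply: eq_bigr => h _; case: ifP => // _; apply: eq_bigr => i _.
congr (_ * (_ * _)); rewrite -IH// => [|h' i' hh]; last first.
  by apply: zE; exact: ltn_trans hh _.
by rewrite reluE zE.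
Qed.

Lemma dn_p1E w z k l :
  (forall h i, (h < l)%N -> (i < dn_n D h)%N -> z (h, i) = (0 < dn_y w None h i)) ->
  dn_p1 w k l = dn_gy w z None l.
Proof.
elim/ltn_ind: l => -[//|l] IH zE; apply/funext => j; rewrite dn_p1S dn_gyS.
congr (_ * _); apply: eq_bigr => h _; apply: eq_bigr => i _ /=.
rewrite -!mulrA; congr (_ * (_ * _)); rewrite -IH// => [|h' i' hh]; last first.
  by apply: zE; exact: ltn_trans hh _.
by rewrite /gate -zE//; case: ifP; rewrite ?mul1r ?mul0r.
Qed.

Lemma dn_gy_drop w z lk hk l : (l < lk)%N ->
  dn_gy w z (Some (lk, hk)) l = dn_gy w z None l.
Proof.
elim/ltn_ind: l => -[//|l] IH llk; apply/funext => j; rewrite !dn_gyS.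
congr (_ * _); apply: eq_bigr => h _ /=.
rewrite ltn_eqF// ltnNge (ltnW llk) /=; apply: eq_bigr => i _.
by rewrite IH// (ltn_trans (ltn_ord h)).
Qed.

Lemma dn_p2_before w lk hk l : (l < lk)%N -> dn_p2 w (Wmid lk hk) l = fun _ => 0.
Proof.
elim/ltn_ind: l => -[//|l] IH llk; apply/funext => j; rewrite dn_p2S.
rewrite big1 ?mulr0// => h _; rewrite big1// => i _.
by rewrite Wmid_eq gtn_eqF// IH ?mulr0// (ltn_trans (ltn_ord h)).
Qed.

(** A path through [W^{lk,hk}] enters layer [lk] from layer [hk] and afterwards visits only layers
    from [lk] on. These are the connections that the reduced network keeps at layers from [lk]
    on. *)
Lemma dn_p2E w z lk hk l : (hk < lk)%N -> (lk <= l)%N ->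
  (forall h i, (h < l)%N -> (i < dn_n D h)%N -> z (h, i) = (0 < dn_y w None h i)) ->
  dn_p2 w (Wmid lk hk) l = dn_gy w z (Some (lk, hk)) l.
Proof.
move=> hklk; elim/ltn_ind: l => -[|l] IH lkl zE; first by move: hklk lkl; lia.
apply/funext => j; rewrite dn_p2S dn_gyS; congr (_ * _); apply: eq_bigr => h _.
have zE' h' i : (h' < h)%N -> (i < dn_n D h')%N -> z (h', i) = (0 < dn_y w None h' i).
  by move=> hh; apply: zE; exact: ltn_trans hh _.
have gate_mul i (p : R) : (i < dn_n D h)%N ->
    gate (dn_y w None h i) * p = if z (h : nat, i) then p else 0.
  by move=> ii; rewrite /gate -zE//; case: ifP; rewrite ?mul1r ?mul0r.
rewrite /=; have [lE|lNE] := eqVneq l.+1 lk.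
  have hlk : (h < lk)%N by rewrite -lE.
  have [hE|hNE] := eqVneq (h : nat) hk.
    apply: eq_bigr => i _; rewrite Wmid_eq -lE -hE !eqxx /= -!mulrA gate_mul//.
    by rewrite (dn_p1E _ zE') dn_gy_drop.
  by rewrite big1// => i _; rewrite Wmid_eq [hk == _]eq_sym (negbTE hNE) andbF
    dn_p2_before// mulr0.
have ltl : (lk < l.+1)%N by rewrite ltn_neqAle eq_sym lNE lkl.
rewrite ltl; have [lkh|hlk] := leqP lk h.
  apply: eq_bigr => i _; rewrite Wmid_eq eq_sym (negbTE lNE) /= -!mulrA gate_mul//.
  by rewrite IH.
by rewrite big1// => i _; rewrite Wmid_eq eq_sym (negbTE lNE) /= dn_p2_before// mulr0.
Qed.

Lemma dn_p2_win w l : dn_p2 w Win l = dn_p1 w Win l.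
Proof.
elim/ltn_ind: l => -[_|l IH]; first by apply/funext.
apply/funext => j; rewrite dn_p2S dn_p1S; congr (_ * _).
by apply: eq_bigr => h _; apply: eq_bigr => i _; rewrite IH// if_same.
Qed.

Lemma dn_fk_endpoints w k : (if k is Wmid _ _ then false else true) ->
  dn_fk D alpha w x k = dn_out D alpha w x None.
Proof.
pose z := fun v => 0 < dn_pre None w v.
have E k' : dn_p1 w k' (dn_L D) = dn_y w None (dn_L D).
  by rewrite (@dn_p1E _ z)// (@dn_yE _ z).
by case: k => // _; rewrite /dn_fk /dn_out -/(dn_p1 _ _ _) -/(dn_p2 _ _ _) -/(dn_y _ _ _)
  ?dn_p2_win E.
Qed.

Lemma dn_outE d w : dn_out D alpha w x d = dn_gout w (dn_gates d w) d.
Proof.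
rewrite /dn_out /dn_gout -/(dn_y _ _ _) (@dn_yE _ (dn_gates d w))// => h i hL ii.
exact: dn_gatesE.
Qed.

Lemma dn_fkE w lk hk : (lk <= dn_L D)%N -> (hk < lk)%N ->
  dn_fk D alpha w x (Wmid lk hk) = dn_gout w (dn_gates None w) (Some (lk, hk)).
Proof.
move=> lkL hklk; rewrite /dn_fk /dn_gout /= -/(dn_p2 _ _ _).
by rewrite (@dn_p2E _ (dn_gates None w))// => h i hL ii; exact: dn_gatesE.
Qed.

Lemma dn_gpreE d w v : v \in dn_neurons -> dn_gpre d w (dn_gates d w) v = dn_pre d w v.
Proof.
case: v => l i; rewrite mem_dn_neurons => /andP[lL _].
rewrite /dn_gpre /dn_pre /= -dn_yE// => h i' hl ii.
by apply: dn_gatesE => //; exact: ltn_trans lL.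
Qed.

(** * Gauge covariance and dependence on the gates *)

Let sg (e : nat * nat -> bool) v : R := (-1) ^+ ((v \in dn_neurons) && e v).

Let sgK e v : sg e v * sg e v = 1.
Proof. by rewrite /sg -signr_addb addbb. Qed.

Lemma dn_gy_gauge e w z d l j :
  dn_gy (wflip (dn_sigma e) w) z d l j = sg e (l, j) * dn_gy w z d l j.
Proof.
elim/ltn_ind: l j => -[|l] IH j.
  rewrite /dn_gy /= /dn_y0 [RHS]mulrCA; congr (_ * _); rewrite big_distrr /=.
  by apply: eq_bigr => i _; rewrite {1}/W /wflip /dn_sigma -mulrA.
rewrite !dn_gyS [RHS]mulrCA; congr (_ * _); rewrite big_distrr /=; apply: eq_bigr => h _.
case: ifP => _; last by rewrite mulr0.
rewrite big_distrr /=; apply: eq_bigr => i _.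
rewrite IH// {1}/W /wflip /dn_sigma signr_addb -/(sg e (l.+1, j)) -/(sg e (h : nat, i : nat)).
rewrite -!mulrA; congr (_ * _); rewrite mulrCA; congr (_ * _).
by case: ifP => _; rewrite ?mulr0// mulrCA [X in _ * X]mulrA sgK mul1r.
Qed.

Lemma dn_gpre_gauge d e w z v : v \in dn_neurons ->
  dn_gpre d (wflip (dn_sigma e) w) z v = (-1) ^+ e v * dn_gpre d w z v.
Proof. by move=> vN; rewrite /dn_gpre dn_gy_gauge -!surjective_pairing /sg vN. Qed.

Lemma dn_gout_gauge d e w z : dn_gout (wflip (dn_sigma e) w) z d = dn_gout w z d.
Proof.
rewrite /dn_gout; congr (_ * _); apply: eq_bigr => j _.
rewrite dn_gy_gauge /sg mem_dn_neurons ltnn /= expr0 mul1r.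
by rewrite /W /wflip /= expr0 mul1r.
Qed.

Lemma dn_gpre_local d w z z' v :
  (forall u, (dn_rank u < dn_rank v)%N -> z u = z' u) ->
  dn_gpre d w z v = dn_gpre d w z' v.
Proof.
case: v => l i zz'; rewrite /dn_gpre /=.
elim/ltn_ind: l i zz' => -[//|l] IH j zz'; rewrite !dn_gyS; congr (_ * _).
apply: eq_bigr => h _; case: ifP => // _; apply: eq_bigr => i _.
rewrite zz'; last exact: ltn_ord.
by rewrite (IH h)// => u uh; apply: zz'; exact: (ltn_trans uh (ltn_ord h)).
Qed.

Lemma dn_gout_setg d w z v b : dn_gpre d w z v = 0 ->
  dn_gout w (setg z v b) d = dn_gout w z d.
Proof.
move=> g0; suff E l j : dn_gy w (setg z v b) d l j = dn_gy w z d l j.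
  by rewrite /dn_gout; congr (_ * _); apply: eq_bigr => j _; rewrite E.
elim/ltn_ind: l j => -[//|l] IH j; rewrite !dn_gyS; congr (_ * _).
apply: eq_bigr => h _; case: ifP => // _; apply: eq_bigr => i _.
rewrite IH//; congr (_ * (_ * _)); rewrite /setg; case: eqP => // vE.
by move: g0; rewrite -vE /dn_gpre /= => ->; rewrite !if_same.
Qed.

(** * Measurability of DenseNet quantities *)

Lemma wmeasurable_dn_y0 j : wmeasurable (fun w => dn_y0 D w x j).
Proof.
apply: wmeasurableM; first exact: wmeasurable_cst.
by apply: wmeasurable_sum => i; apply: wmeasurableM;
  [exact: wmeasurable_W|exact: wmeasurable_cst].
Qed.

Lemma wmeasurable_dn_gy z d l j : wmeasurable (fun w => dn_gy w z d l j).
Proof.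
elim/ltn_ind: l j => -[|l] IH j; first exact: wmeasurable_dn_y0.
apply: (eq_wmeasurable (fun w => dn_gyS w _ _ _ _)).
apply: wmeasurableM; first exact: wmeasurable_cst.
apply: wmeasurable_sum => h; case: (dn_conn _ _ _); last exact: wmeasurable_cst.
apply: wmeasurable_sum => i; apply: wmeasurableM; first exact: wmeasurable_W.
apply: wmeasurableM; first exact: wmeasurable_cst.
by case: (z _); [exact: IH|exact: wmeasurable_cst].
Qed.

Lemma wmeasurable_dn_gout z d : wmeasurable (fun w => dn_gout w z d).
Proof.
apply: wmeasurableM; first exact: wmeasurable_cst.
by apply: wmeasurable_sum => i; apply: wmeasurableM;
  [exact: wmeasurable_W|exact: wmeasurable_dn_gy].
Qed.

Lemma wmeasurable_dn_y d l j : wmeasurable (fun w => dn_y w d l j).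
Proof.
elim/ltn_ind: l j => -[|l] IH j; first exact: wmeasurable_dn_y0.
apply: (eq_wmeasurable (fun w => dn_yS w _ _ _)).
apply: wmeasurableM; first exact: wmeasurable_cst.
apply: wmeasurable_sum => h; case: (dn_conn _ _ _); last exact: wmeasurable_cst.
apply: wmeasurable_sum => i; apply: wmeasurableM; first exact: wmeasurable_W.
apply: wmeasurableM; first exact: wmeasurable_cst.
by apply: wmeasurable_relu; exact: IH.
Qed.

Lemma wmeasurable_dn_out d : wmeasurable (fun w => dn_out D alpha w x d).
Proof.
apply: wmeasurableM; first exact: wmeasurable_cst.
by apply: wmeasurable_sum => i; apply: wmeasurableM;
  [exact: wmeasurable_W|exact: wmeasurable_dn_y].
Qed.

Lemma wmeasurable_dn_p1 k l j : wmeasurable (fun w => dn_p1 w k l j).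
Proof.
elim/ltn_ind: l j => -[|l] IH j; first exact: wmeasurable_dn_y0.
apply: (eq_wmeasurable (fun w => dn_p1S w _ _ _)).
apply: wmeasurableM; first exact: wmeasurable_cst.
apply: wmeasurable_sum => h; apply: wmeasurable_sum => i; apply: wmeasurableM;
  last exact: IH.
apply: wmeasurableM; first exact: wmeasurable_W.
apply: wmeasurableM; first exact: wmeasurable_cst.
by apply: wmeasurable_gate; exact: wmeasurable_dn_y.
Qed.

Lemma wmeasurable_dn_p2 k l j : wmeasurable (fun w => dn_p2 w k l j).
Proof.
elim/ltn_ind: l j => -[|l] IH j.
  rewrite /dn_p2 /=; case: (k == Win); [exact: wmeasurable_dn_y0|exact: wmeasurable_cst].
apply: (eq_wmeasurable (fun w => dn_p2S w _ _ _)).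
apply: wmeasurableM; first exact: wmeasurable_cst.
apply: wmeasurable_sum => h; apply: wmeasurable_sum => i; apply: wmeasurableM;
  last by case: (k == _); [exact: wmeasurable_dn_p1|exact: IH].
apply: wmeasurableM; first exact: wmeasurable_W.
apply: wmeasurableM; first exact: wmeasurable_cst.
by apply: wmeasurable_gate; exact: wmeasurable_dn_y.
Qed.

Lemma wmeasurable_dn_fk k : wmeasurable (fun w => dn_fk D alpha w x k).
Proof.
apply: wmeasurableM; first exact: wmeasurable_cst.
apply: wmeasurable_sum => i; apply: wmeasurableM; first exact: wmeasurable_W.
by case: (k == _); [exact: wmeasurable_dn_p1|exact: wmeasurable_dn_p2].
Qed.

(** * Degenerate neurons and the moments of DenseNets *)

Hypothesis n_gt0 : forall l, (l <= dn_L D)%N -> (0 < dn_n D l)%N.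
Hypothesis alpha_gt0 : 0 < alpha.

Lemma dn_scale_neq0 l : (0 < l <= dn_L D)%N -> dn_scale D alpha l != 0.
Proof.
move=> /andP[l0 ll]; rewrite gt_eqF// sqrtr_gt0 divr_gt0// -natrM ltr0n muln_gt0 l0 andbT.
by apply: n_gt0; move: ll; lia.
Qed.

Lemma mem_dn_keys l h j i : (0 < l <= dn_L D)%N -> (h < l)%N ->
  (j < dn_n D l)%N -> (i < dn_n D h)%N -> (Wmid l h, j, i) \in dn_keys D.
Proof.
move=> ll hm jn il; rewrite !mem_cat; apply/orP; right; apply/orP; left.
apply/flatten_mapP; exists l; first by rewrite mem_iota; lia.
apply/flatten_mapP; exists h; first by rewrite mem_iota; lia.
exact: mem_mat_keys.
Qed.

Lemma dn_gy_upd w z d l l' h' j i t : (l < l')%N ->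
  dn_gy (upd w (Wmid l' h', j, i) t) z d l = dn_gy w z d l.
Proof.
elim/ltn_ind: l => -[//|l] IH ll; apply/funext => j'; rewrite !dn_gyS; congr (_ * _).
apply: eq_bigr => h _; case: ifP => // _; apply: eq_bigr => i' _.
rewrite W_upd_neq; last by rewrite Wmid_eq ltn_eqF.
by rewrite IH// (ltn_trans (ltn_ord h)).
Qed.

Let dn_gact w z h (i : nat) : R :=
  sq2 R * (if z (h, i) then dn_gy w z None h i else 0).

Let dn_gact_upd w z l h h' j i i' t : (h < l)%N ->
  dn_gact (upd w (Wmid l h', j, i) t) z h i' = dn_gact w z h i'.
Proof. by move=> hl; rewrite /dn_gact dn_gy_upd. Qed.

Let wmeasurable_dn_gact z h i : wmeasurable (fun w => dn_gact w z h i).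
Proof.
apply: wmeasurableM; first exact: wmeasurable_cst.
by case: (z _); [exact: wmeasurable_dn_gy|exact: wmeasurable_cst].
Qed.

Lemma dn_gact_deg z l j h : (l < dn_L D)%N -> (j < dn_n D l.+1)%N -> (h <= l)%N ->
  gae (dn_keys D) (fun w => dn_gy w z None l.+1 j = 0 ->
    forall i, (i < dn_n D h)%N -> dn_gact w z h i = 0).
Proof.
move=> lL jn hl.
(* The contribution of the other source layers, which uses other matrices and so is constant in the
   row of [W^{l+1,h}]. *)
pose c w := dn_scale D alpha l.+1 * \sum_(h' < l.+1 | h' != h :> nat)
  \sum_(i < dn_n D h') W w (Wmid l.+1 h') j i * dn_gact w z h' i.
have := @gae_row R (dn_keys D) (Wmid l.+1 h) j (dn_n D h) (dn_scale D alpha l.+1) c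
  (fun i w => dn_gact w z h i).
case.
- by move=> i ilt; exact: mem_dn_keys.
- exact: dn_scale_neq0.
- apply: wmeasurableM; first exact: wmeasurable_cst.
  apply: wmeasurable_sum => h'; apply: wmeasurable_sum => i.
  by apply: wmeasurableM; [exact: wmeasurable_W|exact: wmeasurable_dn_gact].
- by move=> i; exact: wmeasurable_dn_gact.
- move=> i w t; congr (_ * _); apply: eq_bigr => h' hh'; apply: eq_bigr => i' _.
  by rewrite dn_gact_upd// W_upd_neq// Wmid_eq (negbTE hh') andbF.
- by move=> i' i w t; rewrite dn_gact_upd.
move=> H [mH H0 HE HQ]; exists H; split=> // w /HQ Hw a0; apply: Hw.
rewrite -[RHS]a0 dn_gyS /= (bigD1 (Ordinal (hl : (h < l.+1)%N)))//= mulrDr addrC.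
by congr (_ + _); rewrite /c.
Qed.

(** A vanishing preactivation almost surely means that all earlier activations vanish, so every open
    neuron below has zero preactivation and the induction applies to it. Dropping connections cannot
    revive the neuron, and layer 0 is the same in all networks. *)
Lemma dn_gpre_deg z d v : v \in dn_neurons ->
  gae (dn_keys D) (fun w => dn_gpre None w z v = 0 -> dn_gpre d w z v = 0).
Proof.
case: v => l j; rewrite mem_dn_neurons /dn_gpre /= => /andP[].
elim/ltn_ind: l j => -[|l] IH j lL jn; first exact: gaeT.
have row : gae (dn_keys D) (fun w => forall h, (h < l.+1)%N ->
    dn_gy w z None l.+1 j = 0 -> forall i, (i < dn_n D h)%N -> dn_gact w z h i = 0).
  by apply: gae_ord => h hl; apply: dn_gact_deg => //; exact: ltnW.
have : gae (dn_keys D) (fun w => forall h, (h < l.+1)%N -> forall i, (i < dn_n D h)%N ->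
    dn_gy w z None h i = 0 -> dn_gy w z d h i = 0).
  apply: gae_ord => h hl; apply: gae_ord => i ilt; apply: IH => //.
  exact: ltn_trans lL.
move=> /(gae_and row); apply: gae_impl => w [H Hd] a0.
rewrite dn_gyS big1 ?mulr0// => h _; case: ifP => // _; rewrite big1// => i _.
have := H h (ltn_ord h) a0 i (ltn_ord i); rewrite /dn_gact.
case: ifP => _; last by rewrite !mulr0.
move/eqP; rewrite mulf_eq0 (negbTE sq2_neq0) => /eqP b0.
by rewrite Hd// !mulr0.
Qed.

Lemma dn_moments m k : ~~ odd m -> dn_valid D k ->
  Emom (dn_keys D) (fun w => dn_reduced D alpha w x k) m
  = Emom (dn_keys D) (fun w => dn_fk D alpha w x k) m.
Proof.
move=> em; case: k => [_|lk hk kv|_].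
- by congr Emom; apply/funext => w; rewrite dn_fk_endpoints.
- have /andP[/andP[_ lkL] hkm] := kv.
  pose d0 := Some (lk, hk).
  apply: (@asum_cst_inj _ _ dn_neurons (fun _ => false)).
  have avg d f : (forall w, f w = dn_gout w (dn_gates d w) d0) ->
      wmeasurable f ->
      (forall z v, v \in dn_neurons ->
         gae (dn_keys D) (fun w => dn_gpre d w z v = 0 -> dn_gpre d0 w z v = 0)) ->
      asum dn_neurons (fun _ => false) (fun _ => Emom (dn_keys D) f m) =
      gexp (dn_keys D) (fun w => asum dn_neurons (fun _ => false)
        (fun z => (dn_gout w z d0 ^+ m)%:E)).
    move=> fE mf deg.
    apply: (@gauge_average R _ _ _ dn_rank dn_sigma (dn_pre d)
      (dn_gpre d) (fun w z => dn_gout w z d0)) => //.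
    + exact: dn_neurons_uniq.
    + exact: dn_neurons_sorted.
    + by move=> w v; exact: dn_gpreE.
    + by move=> e w z v; exact: dn_gpre_gauge.
    + by move=> e w z; exact: dn_gout_gauge.
    + by move=> w z z' v; exact: dn_gpre_local.
    + move=> z; have := gae_all (deg z); apply: gae_impl => w H v vN a0 b.
      by apply: dn_gout_setg; exact: H.
    + by move=> z; exact: wmeasurable_dn_gout.
  (* Only the gates of the full network, [None], need [dn_gpre_deg]. *)
  rewrite (avg d0)//.
  + rewrite (avg None)//.
    * by move=> w; exact: dn_fkE.
    * exact: wmeasurable_dn_fk.
    * by move=> z v; exact: dn_gpre_deg.
  + by move=> w; exact: dn_outE.
  + exact: wmeasurable_dn_out.
  + by move=> z v _; exact: gaeT.
- by congr Emom; apply/funext => w; rewrite dn_fk_endpoints.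
Qed.

End densenet.

Theorem theorem1 (R : realType) :
  (* ResNet *)
  (forall (A : resnet_arch) (alpha : nat -> R) (x : nat -> R),
     (0 < rn_mb A)%N ->
     (0 < rn_n A)%N ->
     (forall l h, (1 <= l <= rn_L A)%N -> (1 <= h < rn_mb A)%N -> (0 < rn_d A l h)%N) ->
     (forall l, (1 <= l <= rn_L A)%N -> 0 < alpha l) ->
     Num.sqrt (\sum_(i < rn_n0 A) x i ^+ 2) = 1 ->
     forall (m : nat), ~~ odd m ->
     forall k : wid, rn_valid A k ->
       Emom (rn_keys A) (fun w => rn_reduced A alpha w x k) m
       = Emom (rn_keys A) (fun w => rn_fk A alpha w x k) m)
  /\
  (* DenseNet *)
  (forall (D : densenet_arch) (alpha : R) (x : nat -> R),
     (forall l, (l <= dn_L D)%N -> (0 < dn_n D l)%N) ->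
     0 < alpha ->
     Num.sqrt (\sum_(i < dn_n0 D) x i ^+ 2) = 1 ->
     forall (m : nat), ~~ odd m ->
     forall k : wid, dn_valid D k ->
       Emom (dn_keys D) (fun w => dn_reduced D alpha w x k) m
       = Emom (dn_keys D) (fun w => dn_fk D alpha w x k) m).
Proof.
split=> [A alpha x mb0 n0 d0 a0 x1 m em k kv|D alpha x n0 a0 _ m em k kv].
  exact: rn_moments.
exact: dn_moments.
Qed.
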